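(* Let $A$ be a sufficient enlargement for $l_2^{n+m}=l_2^n\oplus l_2^m$ (orthogonal direct sum), and suppose that the images $A_1$ and $A_2$ of $A$ under the orthogonal projections onto $l_2^n$ and $l_2^m$ are small sufficient enlargements for $l_2^n$ and $l_2^m$, respectively. Then $A=A_1+A_2$ (Minkowski sum).
   Context: All spaces are real; $l_2^n$ is $\mathbb{R}^n$ with the Euclidean norm. $B(X)$ denotes the (closed) unit ball of a normed space $X$. A ball in a finite dimensional linear space means a bounded closed convex set with nonempty interior that is symmetric with respect to $0$. A ball $A$ in a finite dimensional normed space $X$ is called a sufficient enlargement for $X$ if for every Banach space $Y$ and every isometric linear embedding of $X$ into $Y$ (identify $X$ with its image) there exists a continuous linear projection $P:Y\to X$ onto $X$ such that $P(B(Y))\subset A$. The absolute projection constant $\lambda(X)$ of a finite dimensional normed space $X$ is the smallest positive real number such that for every isometric embedding of $X$ into a Banach space $Y$ there exists a continuous linear projection $P:Y\to X$ onto $X$ with $\|P\|\le\lambda(X)$. A sufficient enlargement $A$ for $l_2^n$ is called small if $$\int_{O(n)}T(A)\,d\mu(T)=\lambda(l_2^n)\,B(l_2^n),$$ where $\mu$ is the normalized Haar measure on the orthogonal group $O(n)$. Here the integral of convex bodies is understood in the Minkowski sense: it is the compact convex set whose support function is $x\mapsto\int_{O(n)}h(T(A),x)\,d\mu(T)$, where $h(K,x)=\sup_{k\in K}\langle k,x\rangle$. *)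

(* Defs.v *)
From HB Require Import structures.
From mathcomp Require Import all_boot all_order all_algebra.
From mathcomp Require Import all_classical all_reals all_analysis.

Set Implicit Arguments.
Unset Strict Implicit.
Unset Printing Implicit Defensive.

Import Order.TTheory GRing.Theory Num.Theory.
Import numFieldNormedType.Exports.

Local Open Scope classical_set_scope.
Local Open Scope ring_scope.

(* The vector space R^n is 'rV[R]_n with its library
   topology, which comes from the sup norm; since all norms on R^n are
   equivalent, [closed], [compact], [bounded_set] and interior do not depend on
   this choice. The normed space l_2^n is 'rV[R]_n with the norm [l2norm];
   `|x| on row vectors, the sup norm, plays no metric role below. *)

Section euclidean.
Context {R : realType}.

Definition dotp n (x y : 'rV[R]_n) : R := \sum_(i < n) x ord0 i * y ord0 i.

Definition l2norm n (x : 'rV[R]_n) : R := Num.sqrt (dotp x x).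

Definition l2ball n : set 'rV[R]_n := [set x | l2norm x <= 1].

Definition scale_set n (c : R) (A : set 'rV[R]_n) : set 'rV[R]_n :=
  [set c *: x | x in A].

Definition minkowski_sum n (A B : set 'rV[R]_n) : set 'rV[R]_n :=
  [set a + b | a in A & b in B].

Definition linear_ball n (A : set 'rV[R]_n) : Prop :=
  [/\ bounded_set A,
      closed A,
      convex_set (A : set (convex_lmodType 'rV[R]_n)),
      A° !=set0 &
      forall x, A x -> A (- x)].

End euclidean.

(* A finite-dimensional normed space X is given as a norm N on R^n. X is
   identified with its image [range i] in Y, so that a subset A of X becomes
   [i @` A]. *)
Section enlargement.
Context {R : realType}.

Definition isometric_embedding n (N : 'rV[R]_n -> R) (Y : normedModType R)
    (i : {linear 'rV[R]_n -> Y}) : Prop :=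
  forall x, `|i x| = N x.

Definition projection_onto_image n (Y : normedModType R)
    (i : {linear 'rV[R]_n -> Y}) (P : {linear Y -> Y}) : Prop :=
  [/\ continuous P, range P = range i & forall x, P (i x) = i x].

Definition sufficient_enlargement n (N : 'rV[R]_n -> R) (A : set 'rV[R]_n) :
    Prop :=
  linear_ball A /\
  forall (Y : completeNormedModType R) (i : {linear 'rV[R]_n -> Y}),
    isometric_embedding N i ->
    exists2 P : {linear Y -> Y}, projection_onto_image i P &
      P @` [set y | `|y| <= 1] `<=` i @` A.

Definition projection_bound n (N : 'rV[R]_n -> R) (c : R) : Prop :=
  forall (Y : completeNormedModType R) (i : {linear 'rV[R]_n -> Y}),
    isometric_embedding N i ->
    exists2 P : {linear Y -> Y}, projection_onto_image i P &
      forall y, `|P y| <= c * `|y|.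

Definition absolute_projection_constant n (N : 'rV[R]_n -> R) (c : R) : Prop :=
  [/\ 0 < c, projection_bound N c &
      forall c', 0 < c' -> projection_bound N c' -> c <= c'].

End enlargement.

Section haar.
Context {R : realType}.

Definition orthogonal_group n : set 'M[R]_n := [set T | T *m T^T = 1%:M].

Definition borel_mx n := g_sigma_algebraType (@open 'M[R]_n).

(* A Borel measure on the closed set O(n) is the same thing as a Borel measure
   on the space of matrices that is concentrated on O(n). *)
Definition normalized_haar n (mu : probability (borel_mx n) R) : Prop :=
  [/\ mu (@orthogonal_group n) = 1%E,
      forall (U : 'M[R]_n) (S : set (borel_mx n)),
        orthogonal_group U -> measurable S ->
        mu [set T : 'M[R]_n | S (U *m T)] = mu S &
      forall (U : 'M[R]_n) (S : set (borel_mx n)),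
        orthogonal_group U -> measurable S ->
        mu [set T : 'M[R]_n | S (T *m U)] = mu S].

(* Used only for nonempty bounded K. *)
Definition support_fun n (K : set 'rV[R]_n) (x : 'rV[R]_n) : R :=
  sup [set dotp k x | k in K].

(* C is the Minkowski integral of F over O(n) with respect to mu. *)
Definition is_minkowski_integral n (mu : probability (borel_mx n) R)
    (F : 'M[R]_n -> set 'rV[R]_n) (C : set 'rV[R]_n) : Prop :=
  [/\ C !=set0, compact C, convex_set (C : set (convex_lmodType 'rV[R]_n)) &
      forall x, (support_fun C x)%:E =
        (\int[mu]_(T in @orthogonal_group n) (support_fun (F T) x)%:E)%E].

(* Matrices act on row vectors on the right: T(A) = {a T : a in A}. *)
Definition mx_image n (T : 'M[R]_n) (A : set 'rV[R]_n) : set 'rV[R]_n :=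
  [set a *m T | a in A].

(* The Haar measure and the absolute projection constant are unique, so the
   existential quantifiers merely name them. *)
Definition small_sufficient_enlargement n (A : set 'rV[R]_n) : Prop :=
  sufficient_enlargement (@l2norm R n) A /\
  exists (mu : probability (borel_mx n) R) (c : R),
    [/\ normalized_haar mu,
        absolute_projection_constant (@l2norm R n) c &
        is_minkowski_integral mu (fun T => mx_image T A)
          (scale_set c (@l2ball R n))].

End haar.

(* l_2^{n+m} = l_2^n (+) l_2^m : the first n and the last m coordinates. The
   orthogonal projections are [lsubmx] and [rsubmx]; [row_mx x 0] and
   [row_mx 0 y] embed the summands. *)
Section direct_sum.
Context {R : realType}.

Definition embed_l n m (x : 'rV[R]_n) : 'rV[R]_(n + m) := row_mx x 0.
Definition embed_r n m (y : 'rV[R]_m) : 'rV[R]_(n + m) := row_mx 0 y.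

End direct_sum.

(* Main.v *)
Require Import Defs.
From HB Require Import structures.
From mathcomp Require Import all_boot all_order all_algebra.
From mathcomp Require Import all_classical all_reals all_analysis.
From mathcomp Require Import measurable_realfun ring lra.

(* Let kappa be the mean of |<u, e>| over the unit sphere of l_2^n. Averaging
   rank one operators gives lambda(l_2^n) <= n kappa. Project l_inf(S), S the
   unit ball of l_2^(n+m), onto l_2^(n+m) with the unit ball B going into A, and
   follow this by the orthogonal projection onto l_2^n; call the composite p,
   so that p(B) lies in A_1. Write s_1 for the l_2^n-component of s in S. The
   functions
     f_u(s) = |s_1| sgn <u, s_1> + g(s) <u, b>
   have mean against u equal to kappa s_1 + g(s) b / n. If |s_1| + |g(s)| <= 1
   they lie in B, whence
     n kappa + <p g, b> / n <= mean h(p(B), u) <= mean h(A_1, u)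
                             = lambda(l_2^n) <= n kappa.
   Therefore h(p(B)) = h(A_1), and p kills every g that vanishes near
   |s_1| = 1. The same holds for l_2^m, with |s_2| = 1. These two parts of S are
   disjoint, so functions that nearly attain h(A_1, x_1) and h(A_2, x_2) can be
   glued to one function in B, and h(A, x) >= h(A_1, x_1) + h(A_2, x_2). *)

(** The left inequality of the chain is a trace computation. The mean of <p f_u, u> is the sum over
    i of the i-th coordinate of p(mean of u_i f_u), and the mean of u_i f_u is the function kappa
    s_1i + g(s) b_i / n. As p is the identity on the embedded l_2^n, the first terms add up to n
    kappa. Both conclusions come from the chain closing up: with b along p g, a nonzero p g would
    break it; with g = 0, the nonnegative continuous gap between the two support functions has mean
    zero and so vanishes. The obstacle is that p is an arbitrary bounded operator on a nonseparable
    space. Means are therefore replaced by finite sums with nodes in O(n), whose error depends only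
    on a Lipschitz constant. This is why sgn is smoothed and why explicit constants are carried
    along. *)

Set Implicit Arguments.
Unset Strict Implicit.
Unset Printing Implicit Defensive.

Import Order.TTheory GRing.Theory Num.Theory.
Import numFieldNormedType.Exports.

Local Open Scope classical_set_scope.
Local Open Scope ring_scope.

(** * Euclidean inner product and norm *)

Section inner_product.
Context {R : realType}.
Implicit Types n : nat.

Lemma dotpE n (x y : 'rV[R]_n) : dotp x y = (x *m y^T) 0 0.
Proof. by rewrite !mxE; apply: eq_bigr => i _; rewrite !mxE. Qed.

Lemma dotpC n (x y : 'rV[R]_n) : dotp x y = dotp y x.
Proof. by apply: eq_bigr => i _; rewrite mulrC. Qed.

Lemma dotpDl n (x y z : 'rV[R]_n) : dotp (x + y) z = dotp x z + dotp y z.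
Proof. by rewrite !dotpE mulmxDl mxE. Qed.

Lemma dotpZl n a (x y : 'rV[R]_n) : dotp (a *: x) y = a * dotp x y.
Proof. by rewrite !dotpE -scalemxAl mxE. Qed.

Lemma dotpDr n (x y z : 'rV[R]_n) : dotp z (x + y) = dotp z x + dotp z y.
Proof. by rewrite !(dotpC z) dotpDl. Qed.

Lemma dotpZr n a (x y : 'rV[R]_n) : dotp x (a *: y) = a * dotp x y.
Proof. by rewrite !(dotpC x) dotpZl. Qed.

Lemma dotpNl n (x y : 'rV[R]_n) : dotp (- x) y = - dotp x y.
Proof. by rewrite -scaleN1r dotpZl mulN1r. Qed.

Lemma dotpNr n (x y : 'rV[R]_n) : dotp x (- y) = - dotp x y.
Proof. by rewrite dotpC dotpNl dotpC. Qed.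

Lemma dotpBl n (x y z : 'rV[R]_n) : dotp (x - y) z = dotp x z - dotp y z.
Proof. by rewrite dotpDl dotpNl. Qed.

Lemma dotpBr n (x y z : 'rV[R]_n) : dotp z (x - y) = dotp z x - dotp z y.
Proof. by rewrite dotpDr dotpNr. Qed.

Lemma dotp0l n (x : 'rV[R]_n) : dotp 0 x = 0.
Proof. by rewrite dotpE mul0mx mxE. Qed.

Lemma dotp0r n (x : 'rV[R]_n) : dotp x 0 = 0.
Proof. by rewrite dotpC dotp0l. Qed.

Lemma dotp_suml n I (r : seq I) (F : I -> 'rV[R]_n) x :
  dotp (\sum_(i <- r) F i) x = \sum_(i <- r) dotp (F i) x.
Proof.
elim: r => [|i r ih]; first by rewrite !big_nil dotp0l.
by rewrite !big_cons dotpDl ih.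
Qed.

Lemma dotp_mulmxl n k (x : 'rV[R]_n) (M : 'M[R]_(n, k)) (y : 'rV[R]_k) :
  dotp (x *m M) y = dotp x (y *m M^T).
Proof. by rewrite !dotpE trmx_mul trmxK mulmxA. Qed.

Lemma dotp_delta n (x : 'rV[R]_n) i : dotp x (delta_mx 0 i) = x 0 i.
Proof.
rewrite /dotp (bigD1 i)//= mxE !eqxx mulr1 big1 ?addr0// => j ji.
by rewrite mxE (negbTE ji) andbF mulr0.
Qed.

Lemma dotp_row_mx n m (x : 'rV[R]_(n + m)) (y : 'rV[R]_(n + m)) :
  dotp x y = dotp (lsubmx x) (lsubmx y) + dotp (rsubmx x) (rsubmx y).
Proof.
rewrite /dotp big_split_ord/=; congr (_ + _).
  by apply: eq_bigr => i _; rewrite !mxE.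
by apply: eq_bigr => i _; rewrite !mxE.
Qed.

Lemma dotp_ge0 n (x : 'rV[R]_n) : 0 <= dotp x x.
Proof. by apply: sumr_ge0 => i _; rewrite -expr2 sqr_ge0. Qed.

Lemma dotp_eq0 n (x : 'rV[R]_n) : dotp x x = 0 -> x = 0.
Proof.
move=> x0; apply/rowP => i; rewrite mxE; apply/eqP.
have /psumr_eq0P/(_ x0) : forall i, true -> 0 <= x ord0 i * x ord0 i.
  by move=> j _; rewrite -expr2 sqr_ge0.
by move=> /(_ i isT)/eqP; rewrite mulf_eq0 orbb.
Qed.

Lemma l2norm_ge0 n (x : 'rV[R]_n) : 0 <= l2norm x.
Proof. exact: sqrtr_ge0. Qed.

Lemma l2norm_sqr n (x : 'rV[R]_n) : l2norm x ^+ 2 = dotp x x.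
Proof. by rewrite sqr_sqrtr// dotp_ge0. Qed.

Lemma l2norm0 n : l2norm (0 : 'rV[R]_n) = 0.
Proof. by rewrite /l2norm dotp0l sqrtr0. Qed.

Lemma l2norm_eq0 n (x : 'rV[R]_n) : l2norm x = 0 -> x = 0.
Proof. by move=> x0; apply: dotp_eq0; rewrite -l2norm_sqr x0 expr0n. Qed.

Lemma l2normZ n a (x : 'rV[R]_n) : l2norm (a *: x) = `|a| * l2norm x.
Proof.
by rewrite /l2norm dotpZl dotpZr mulrA -expr2 sqrtrM ?sqr_ge0// sqrtr_sqr.
Qed.

Lemma l2normN n (x : 'rV[R]_n) : l2norm (- x) = l2norm x.
Proof. by rewrite -scaleN1r l2normZ normrN1 mul1r. Qed.

Lemma dotp_le n (x y : 'rV[R]_n) : dotp x y <= l2norm x * l2norm y.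
Proof.
have [x0|x0] := eqVneq (l2norm x) 0.
  by rewrite x0 (l2norm_eq0 x0) dotp0l mul0r.
have [y0|y0] := eqVneq (l2norm y) 0.
  by rewrite y0 (l2norm_eq0 y0) dotp0r mulr0.
(* This square equals 2 |x| |y| (|x| |y| - <x,y>). *)
have := dotp_ge0 (l2norm y *: x - l2norm x *: y).
rewrite dotpBl !dotpBr !dotpZl !dotpZr (dotpC y x) -!l2norm_sqr => h.
have xp : 0 < l2norm x by rewrite lt_def x0 l2norm_ge0.
have yp : 0 < l2norm y by rewrite lt_def y0 l2norm_ge0.
rewrite -(ler_pM2l (mulr_gt0 xp yp)).
lra.
Qed.

Lemma normr_dotp_le n (x y : 'rV[R]_n) : `|dotp x y| <= l2norm x * l2norm y.
Proof.
rewrite ler_norml dotp_le andbT -(l2normN x) lerNl -dotpNl.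
exact: dotp_le.
Qed.

Lemma l2normD n (x y : 'rV[R]_n) : l2norm (x + y) <= l2norm x + l2norm y.
Proof.
rewrite -(ler_pXn2r (ltn0Sn 1)) ?nnegrE ?addr_ge0 ?l2norm_ge0//.
rewrite l2norm_sqr dotpDl !dotpDr (dotpC y x) sqrrD !l2norm_sqr.
have := dotp_le x y; lra.
Qed.

Lemma normr_coord_le n (x : 'rV[R]_n) i : `|x 0 i| <= l2norm x.
Proof.
rewrite -(ler_pXn2r (ltn0Sn 1)) ?nnegrE ?l2norm_ge0// l2norm_sqr.
rewrite /dotp (bigD1 i)//= real_normK ?num_real// -expr2 lerDl.
by apply: sumr_ge0 => j _; rewrite -expr2 sqr_ge0.
Qed.

Lemma l2norm_le_sum n (x : 'rV[R]_n) : l2norm x <= \sum_i `|x 0 i|.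
Proof.
have s0 : 0 <= \sum_i `|x 0 i| by apply: sumr_ge0.
rewrite -(ler_pXn2r (ltn0Sn 1)) ?nnegrE ?l2norm_ge0// l2norm_sqr.
rewrite expr2 mulr_sumr; apply: ler_sum => i _.
rewrite mulrC (le_trans (ler_norm _))// normrM ler_wpM2r//.
by rewrite (bigD1 i)//= lerDl sumr_ge0.
Qed.

Lemma l2norm_le_norm n (x : 'rV[R]_n) : l2norm x <= n%:R * `|x|.
Proof.
apply: (le_trans (l2norm_le_sum x)).
rewrite mulr_natl -[leRHS](_ : \sum_(i < n) `|x| = _).
  by apply: ler_sum => i _; rewrite [leRHS]/Num.norm/= mx_normrE (le_bigmax _
    (fun ij => `|x ij.1 ij.2|) (0, i)).
by rewrite sumr_const card_ord.
Qed.

Lemma l2norm_unit n (x : 'rV[R]_n) : x != 0 ->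
  l2norm ((l2norm x)^-1 *: x) = 1.
Proof.
move=> x0; rewrite l2normZ ger0_norm ?invr_ge0 ?l2norm_ge0// mulVf//.
by apply: contra_neq x0 => /l2norm_eq0.
Qed.

Lemma l2norm_coord_le n (x : 'rV[R]_n) B :
  (forall i, `|x 0 i| <= B) -> l2norm x <= n%:R * B.
Proof.
move=> h; apply: (le_trans (l2norm_le_sum x)).
rewrite mulr_natl -[leRHS](_ : \sum_(i < n) B = _); first exact: ler_sum.
by rewrite sumr_const card_ord.
Qed.

Lemma normr_entry_le n k (M : 'M[R]_(n, k)) i j : `|M i j| <= `|M|.
Proof.
by rewrite [leRHS]/Num.norm/= mx_normrE (le_bigmax _ (fun ij => `|M ij.1 ij.2|)
  (i, j)).
Qed.

(** The constant is crude; it serves only to turn closeness of matrices in the sup norm into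
    Euclidean closeness of vectors. *)
Lemma l2norm_mulmx_le n (x : 'rV[R]_n) (M : 'M[R]_n) :
  l2norm (x *m M) <= n%:R * (n%:R * `|M|) * l2norm x.
Proof.
rewrite -mulrA; apply: l2norm_coord_le => i; rewrite mxE.
apply: (le_trans (ler_norm_sum _ _ _)).
rewrite -mulrA mulr_natl -[leRHS](_ : \sum_(j < n) `|M| * l2norm x = _).
  by apply: ler_sum => j _; rewrite normrM mulrC ler_pM// ?normr_entry_le//
    normr_coord_le.
by rewrite sumr_const card_ord.
Qed.

End inner_product.

(** * Orthogonal matrices and reflections *)

Section orthogonal.
Context {R : realType} {n : nat}.
Implicit Types (x y z : 'rV[R]_n) (T U : 'M[R]_n).

Lemma orthogonal_trmx U : orthogonal_group U -> orthogonal_group U^T.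
Proof. by rewrite /orthogonal_group/= trmxK => /mulmx1C. Qed.

Lemma orthogonal_mulmx T U : orthogonal_group T -> orthogonal_group U ->
  orthogonal_group (T *m U).
Proof.
rewrite /orthogonal_group/= => hT hU.
by rewrite trmx_mul mulmxA -(mulmxA T) hU mulmx1.
Qed.

Lemma orthogonal1 : orthogonal_group (1%:M : 'M[R]_n).
Proof. by rewrite /orthogonal_group/= trmx1 mulmx1. Qed.

Lemma dotp_orthogonal U x y : orthogonal_group U ->
  dotp (x *m U) (y *m U) = dotp x y.
Proof. by rewrite dotp_mulmxl -mulmxA => ->; rewrite mulmx1. Qed.

Lemma l2norm_orthogonal U x : orthogonal_group U -> l2norm (x *m U) = l2norm x.
Proof. by move=> hU; rewrite /l2norm dotp_orthogonal. Qed.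

Lemma orthogonal_norm_le1 U : orthogonal_group U -> `|U| <= 1.
Proof.
move=> hU; rewrite [leLHS]/Num.norm/= mx_normrE; apply/bigmax_leP;
  split => // -[i j] _ /=.
have -> : U i j = (delta_mx 0 i *m U : 'rV_n) 0 j by rewrite -rowE mxE.
apply: (le_trans (normr_coord_le _ _)); rewrite l2norm_orthogonal//.
by rewrite /l2norm dotp_delta mxE !eqxx sqrtr1.
Qed.

Definition reflection z : 'M[R]_n := 1%:M - (2 / dotp z z) *: (z^T *m z).

Lemma mul_reflection x z :
  x *m reflection z = x - (2 * dotp x z / dotp z z) *: z.
Proof.
rewrite mulmxBr mulmx1 -scalemxAr mulmxA; congr (_ - _).
rewrite [x *m z^T]mx11_scalar mul_scalar_mx scalerA -dotpE; congr (_ *: _).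
by rewrite mulrAC.
Qed.

Lemma reflection_orthogonal z : z != 0 -> orthogonal_group (reflection z).
Proof.
move=> z0; have zz0 : dotp z z != 0 by apply: contra_neq z0 => /dotp_eq0.
(* By symmetry, orthogonality means that the reflection is an involution, which is checked on the
   rows of the identity. *)
have sym : (reflection z)^T = reflection z.
  by rewrite /reflection linearB/= trmx1 linearZ/= trmx_mul trmxK.
rewrite /orthogonal_group/= sym; apply/row_matrixP => i.
rewrite [LHS]rowE mulmxA !mul_reflection row1 dotpBl dotpZl.
rewrite -addrA -opprD -scalerDl.
set a := dotp _ _; set b := dotp _ _ in zz0 *.
rewrite (_ : 2 * a / b + _ = 0) ?scale0r ?subr0//.
by field; exact: zz0.
Qed.

(** The reflection along x - y exchanges two vectors of equal norm. *)
Lemma orthogonal_transitive x y : l2norm x = l2norm y ->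
  exists2 U, orthogonal_group U & x *m U = y.
Proof.
move=> xy; have [->|neq] := eqVneq x y.
  by exists 1%:M; [exact: orthogonal1|rewrite mulmx1].
have z0 : x - y != 0 by rewrite subr_eq0.
have zz0 : dotp (x - y) (x - y) != 0 by apply: contra_neq z0 => /dotp_eq0.
exists (reflection (x - y)); first exact: reflection_orthogonal.
rewrite mul_reflection (_ : _ / _ = 1) ?scale1r ?subKr//.
have e : dotp (x - y) (x - y) = 2 * dotp x (x - y).
  have : dotp x x = dotp y y by rewrite -!l2norm_sqr xy.
  rewrite dotpBl !dotpBr (dotpC y x) => ->; ring.
by rewrite -e divff.
Qed.

End orthogonal.

(** * Support functions of bounded sets *)

Section support_function.
Context {R : realType} {n : nat}.
Implicit Types (x y : 'rV[R]_n) (K : set 'rV[R]_n).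

(** [sup] is meaningful only for nonempty sets bounded above, so these lemmas carry a norm bound
    [M]. *)
Lemma support_fun_ge K M k x :
  (forall a, K a -> l2norm a <= M) -> K k -> dotp k x <= support_fun K x.
Proof.
move=> KM Kk; apply: ub_le_sup; last by exists k.
exists (M * l2norm x) => _ [a Ka <-].
by rewrite (le_trans (dotp_le _ _))// ler_wpM2r ?l2norm_ge0 ?KM.
Qed.

Arguments support_fun_ge [K M k] x.

Lemma support_fun_le K B x :
  K !=set0 -> (forall a, K a -> dotp a x <= B) -> support_fun K x <= B.
Proof.
move=> [k Kk] h; apply: ge_sup; first by exists (dotp k x), k.
by move=> _ [a Ka <-]; exact: h.
Qed.

Lemma support_fun_lipschitz K M x y :
  K !=set0 -> (forall a, K a -> l2norm a <= M) ->
  `|support_fun K x - support_fun K y| <= M * l2norm (x - y).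
Proof.
move=> K0 KM.
have step u v : support_fun K u - support_fun K v <= M * l2norm (u - v).
  rewrite lerBlDl; apply: support_fun_le => // a Ka.
  have -> : dotp a u = dotp a v + dotp a (u - v) by rewrite -dotpDr addrC subrK.
  apply: lerD; first exact: (support_fun_ge _ KM).
  by rewrite (le_trans (dotp_le _ _))// ler_wpM2r ?l2norm_ge0 ?KM.
by rewrite ler_norml step andbT lerNl opprB -(l2normN (x - y)) opprB step.
Qed.

(** Averaging the bodies T(K) in a fixed direction e thus becomes averaging the support function of
    K over the points e T^T of the sphere. *)
Lemma support_fun_mx_image T K x :
  support_fun (mx_image T K) x = support_fun K (x *m T^T).
Proof.
congr sup; apply/seteqP; split => [_ [_ [a Ka <-] <-]|_ [a Ka <-]].
  by exists a; rewrite // dotp_mulmxl.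
by exists (a *m T); [exists a|rewrite dotp_mulmxl].
Qed.

Lemma support_funZ K M a x : K !=set0 -> (forall k, K k -> l2norm k <= M) ->
  0 <= a -> support_fun K (a *: x) = a * support_fun K x.
Proof.
move=> K0 KM; rewrite le0r => /predU1P[->|a0].
  rewrite scale0r mul0r; apply/eqP; rewrite eq_le; apply/andP; split.
    by apply: support_fun_le => // k _; rewrite dotp0r.
  by have [k Kk] := K0; have := support_fun_ge 0 KM Kk; rewrite dotp0r.
apply/eqP; rewrite eq_le; apply/andP; split.
  apply: support_fun_le => // k Kk.
  by rewrite dotpZr ler_pM2l//; apply: (support_fun_ge _ KM).
rewrite -ler_pdivlMl//; apply: support_fun_le => // k Kk.
by rewrite ler_pdivlMl// -dotpZr; apply: (support_fun_ge _ KM).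
Qed.

Lemma support_fun_l2ball c x : 0 <= c ->
  support_fun (scale_set c (@l2ball R n)) x = c * l2norm x.
Proof.
move=> c0; apply/eqP; rewrite eq_le; apply/andP; split.
  apply: support_fun_le.
    by exists (c *: 0), 0; rewrite // /l2ball/= l2norm0.
  move=> _ [b b1 <-]; rewrite dotpZl ler_wpM2l// (le_trans (dotp_le _ _))//.
  by rewrite ler_piMl ?l2norm_ge0.
have [->|x0] := eqVneq x 0.
  rewrite l2norm0 mulr0 -(dotp0r (c *: (0 : 'rV[R]_n))).
  apply: (@support_fun_ge _ c); last by exists 0; rewrite // /l2ball/= l2norm0.
  by move=> _ [b b1 <-]; rewrite l2normZ ger0_norm// ler_piMr.
have x1 := l2norm_unit x0.
have xx : dotp ((l2norm x)^-1 *: x) x = l2norm x.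
  rewrite dotpZl -l2norm_sqr expr2 mulrA mulVf ?mul1r//.
  by apply: contra_neq x0 => /l2norm_eq0.
rewrite -{1}xx -dotpZl; apply: (@support_fun_ge _ c).
  by move=> _ [b b1 <-]; rewrite l2normZ ger0_norm// ler_piMr.
by exists ((l2norm x)^-1 *: x); rewrite // /l2ball/= x1.
Qed.

End support_function.

(** * Lipschitz functions and Borel measurability on matrices *)

Section lipschitz.
Context {R : realType}.

Lemma lipschitz_continuous_fun (V W : normedModType R) (f : V -> W) L :
  (forall x y, `|f x - f y| <= L * `|x - y|) -> continuous f.
Proof.
move=> fL x; apply/cvgrPdist_lt => e e0.
(* Positive whatever the sign of [L], so it can be divided by. *)
have L1 : 0 < `|L| + 1 by rewrite ltr_wpDl.
near=> y.
rewrite (le_lt_trans (fL _ _))// (@le_lt_trans _ _ ((`|L| + 1) * `|x - y|))//.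
  by rewrite ler_wpM2r// (le_trans (ler_norm L))// lerDl.
rewrite -ltr_pdivlMl//; near: y.
apply: cvgr_dist_lt; last by rewrite mulr_gt0 ?invr_gt0.
exact: cvg_id.
Unshelve. all: by end_near.
Qed.

Lemma open_borel_mx n (S : set 'M[R]_n) : open S ->
  measurable (S : set (@borel_mx R n)).
Proof. by move=> oS; apply: sub_sigma_algebra. Qed.

Lemma continuous_measurable_borel_mx n (f : 'M[R]_n -> R) :
  continuous f -> measurable_fun setT (f : @borel_mx R n -> R).
Proof.
move=> /continuousP cf; apply: (measurability _ (@RGenOInfty.measurableE R)).
move=> _ [_ [a ->] <-]; rewrite setTI; apply: open_borel_mx.
exact/cf/interval_open.
Qed.

Lemma normr_mulmx_le n (M : 'M[R]_n) (T : 'M[R]_n) : `|M *m T| <= n%:R * `|M| *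
  `|T|.
Proof.
rewrite [leLHS]/Num.norm/= mx_normrE; apply/bigmax_leP; split => [|[i j] _ /=].
  by rewrite !mulr_ge0.
rewrite mxE; apply: (le_trans (ler_norm_sum _ _ _)).
rewrite -mulrA mulr_natl -[leRHS](_ : \sum_(j < n) `|M| * `|T| = _).
  by apply: ler_sum => k _; rewrite normrM ler_pM// normr_entry_le.
by rewrite sumr_const card_ord.
Qed.

Lemma measurable_mulmx n (U : 'M[R]_n) :
  measurable_fun setT (fun T : @borel_mx R n => (U *m T : @borel_mx R n)).
Proof.
apply: (@measurability _ _ (@borel_mx R n) (@borel_mx R n) setT _ (@open
  'M[R]_n)); first by []; move=> _ [S oS <-]; rewrite setTI.
apply: open_borel_mx; move: S oS; apply/continuousP.
apply: (@lipschitz_continuous_fun _ _ _ (n%:R * `|U|)) => S T.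
by rewrite -mulmxBr normr_mulmx_le.
Qed.

Lemma continuous_entry n (i j : 'I_n) : continuous (fun T : 'M[R]_n => T i j).
Proof.
apply: (@lipschitz_continuous_fun _ _ _ 1) => S T.
by rewrite mul1r (le_trans _ (normr_entry_le (S - T) i j))// !mxE.
Qed.

Lemma measurable_entry n (i j : 'I_n) :
  measurable_fun setT (fun T : @borel_mx R n => (T : 'M[R]_n) i j).
Proof. exact: (continuous_measurable_borel_mx (@continuous_entry n i j)). Qed.

(** O(n) is cut out by finitely many polynomial equations in the entries. *)
Lemma measurable_orthogonal_group n :
  measurable (@orthogonal_group R n : set (@borel_mx R n)).
Proof.
have -> : (@orthogonal_group R n : set (@borel_mx R n)) =
    \bigcap_(ij in [set: 'I_n * 'I_n])
      [set T | \sum_k (T : 'M[R]_n) ij.1 k * (T : 'M[R]_n) ij.2 k \in [set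
        (1%:M : 'M[R]_n) ij.1 ij.2]].
  apply/seteqP; split => [T hT [i j] _|T h] /=.
    rewrite inE -hT mxE; apply: eq_bigr => k _; by rewrite mxE.
  apply/matrixP => i j; have /= := h (i, j) I; rewrite inE => <-.
  by rewrite mxE; apply: eq_bigr => k _; rewrite mxE.
apply: fin_bigcap_measurable; first exact: finite_finset.
move=> [i j] _ /=; rewrite -[X in measurable X]setTI.
under eq_set do rewrite inE.
have : measurable_fun setT (fun T : @borel_mx R n => \sum_k (T : 'M[R]_n) i k *
  (T : 'M[R]_n) j k).
  by apply: measurable_sum => k; apply: measurable_funM;
    exact: measurable_entry.
by move=> /(_ measurableT [set (1%:M : 'M[R]_n) i j]); apply.
Qed.

End lipschitz.

(** * Means with respect to the Haar measure *)

Section haar_mean.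
Context {R : realType} {n : nat} (mu : probability (@borel_mx R n) R).
Hypothesis haar_mu : normalized_haar mu.
Local Notation O := (@orthogonal_group R n).
Implicit Types (f g : 'M[R]_n -> R) (T U S : 'M[R]_n).

Definition haar_mean f : R := Rintegral mu O f.

(** The bound is asked for on O(n) only, because functions such as u |-> <u, x> are unbounded on the
    space of all matrices. *)
Definition bounded_measurable f :=
  measurable_fun setT (f : @borel_mx R n -> R) /\
  exists M, forall T, O T -> `|f T| <= M.

Lemma mu_orthogonal_group : mu O = 1%E.
Proof. by case: haar_mu. Qed.

Lemma bounded_measurable_integrable f : bounded_measurable f ->
  mu.-integrable (O : set (@borel_mx R n)) (EFin \o f).
Proof.
move=> [mf [M fM]]; apply: measurable_bounded_integrable.
- exact: measurable_orthogonal_group.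
- by apply: le_lt_trans (ltry 1); apply: probability_le1;
  exact: measurable_orthogonal_group.
- exact: measurable_funTS.
- exists M; split; first exact: num_real.
  by move=> x Mx T OT; apply: (le_trans (fM T OT)); exact: ltW.
Qed.

Lemma bounded_measurable_cst a : bounded_measurable (fun=> a).
Proof. by split; [exact: measurable_cst|exists `|a|]. Qed.

Lemma bounded_measurableD f g : bounded_measurable f -> bounded_measurable g ->
  bounded_measurable (fun T => f T + g T).
Proof.
move=> [mf [M fM]] [mg [N gN]]; split; first exact: measurable_funD.
by exists (M + N) => T OT; rewrite (le_trans (ler_normD _ _))// lerD ?fM ?gN.
Qed.

Lemma bounded_measurableM f g : bounded_measurable f -> bounded_measurable g ->
  bounded_measurable (fun T => f T * g T).
Proof.
move=> [mf [M fM]] [mg [N gN]]; split; first exact: measurable_funM.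
by exists (M * N) => T OT; rewrite normrM ler_pM ?fM ?gN.
Qed.

Lemma bounded_measurableZ a f : bounded_measurable f ->
  bounded_measurable (fun T => a * f T).
Proof. by apply: bounded_measurableM; exact: bounded_measurable_cst. Qed.

Lemma bounded_measurable_sum I (r : seq I) (F : I -> 'M[R]_n -> R) :
  (forall i, bounded_measurable (F i)) ->
  bounded_measurable (fun T => \sum_(i <- r) F i T).
Proof.
move=> hF; elim: r => [|i r ih].
  by under eq_fun do rewrite big_nil; exact: bounded_measurable_cst.
by under eq_fun do rewrite big_cons; exact: bounded_measurableD.
Qed.

Lemma bounded_measurable_mulmx U f : O U -> bounded_measurable f ->
  bounded_measurable (fun T => f (U *m T)).
Proof.
move=> OU [mf [M fM]]; split.
  by apply: (measurableT_comp mf); exact: measurable_mulmx.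
by exists M => T OT; apply: fM; exact: orthogonal_mulmx.
Qed.

Lemma haar_mean_cst a : haar_mean (fun=> a) = a.
Proof.
rewrite /haar_mean Rintegral_cst; last exact: measurable_orthogonal_group.
have : fine (mu O) = 1 by rewrite mu_orthogonal_group.
by move=> /= ->; rewrite mulr1.
Qed.

Lemma haar_meanD f g : bounded_measurable f -> bounded_measurable g ->
  haar_mean (fun T => f T + g T) = haar_mean f + haar_mean g.
Proof.
move=> hf hg; apply: RintegralD; first exact: measurable_orthogonal_group.
  exact: bounded_measurable_integrable.
exact: bounded_measurable_integrable.
Qed.

Lemma haar_meanZ a f : bounded_measurable f ->
  haar_mean (fun T => a * f T) = a * haar_mean f.
Proof.
move=> hf; apply: RintegralZl; first exact: measurable_orthogonal_group.
exact: bounded_measurable_integrable.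
Qed.

Lemma haar_mean_sum I (r : seq I) (F : I -> 'M[R]_n -> R) :
  (forall i, bounded_measurable (F i)) ->
  haar_mean (fun T => \sum_(i <- r) F i T) = \sum_(i <- r) haar_mean (F i).
Proof.
move=> hF; elim: r => [|i r ih].
  by under eq_fun do rewrite big_nil; rewrite big_nil haar_mean_cst.
under eq_fun do rewrite big_cons.
by rewrite haar_meanD ?big_cons ?ih//; exact: bounded_measurable_sum.
Qed.

Lemma haar_mean_le f g : bounded_measurable f -> bounded_measurable g ->
  (forall T, O T -> f T <= g T) -> haar_mean f <= haar_mean g.
Proof.
move=> hf hg fg; apply: le_Rintegral => //.
- exact: measurable_orthogonal_group.
- exact: bounded_measurable_integrable.
- exact: bounded_measurable_integrable.
Qed.

Lemma eq_haar_mean f g : (forall T, O T -> f T = g T) ->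
  haar_mean f = haar_mean g.
Proof. by move=> fg; apply: eq_Rintegral => T; rewrite inE; exact: fg. Qed.

Lemma haar_mean_dist f g e : bounded_measurable f -> bounded_measurable g ->
  (forall T, O T -> `|f T - g T| <= e) -> `|haar_mean f - haar_mean g| <= e.
Proof.
have step h k : bounded_measurable h -> bounded_measurable k ->
    (forall T, O T -> `|h T - k T| <= e) -> haar_mean h - haar_mean k <= e.
  move=> hh hk hke; rewrite lerBlDl -[X in _ + X](haar_mean_cst e).
  have he := bounded_measurable_cst e.
  rewrite -haar_meanD//; apply: haar_mean_le => //.
    exact: bounded_measurableD.
  by move=> T /hke; rewrite ler_norml lerBlDl => /andP[_].
move=> hf hg fg; rewrite ler_norml (step f g)// andbT lerNl opprB step//.
by move=> T OT; rewrite distrC fg.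
Qed.

(** Left multiplication by [U] pushes [mu] forward to itself, and the preimage of O(n) under it is
    O(n). *)
Lemma haar_mean_mulmx U f : O U -> bounded_measurable f ->
  haar_mean (fun T => f (U *m T)) = haar_mean f.
Proof.
move=> OU hf; have [mf _] := hf.
have mU := @measurable_mulmx R n U.
have preO : (fun T => U *m T) @^-1` O = O.
  apply/seteqP; split => T /= hT; last exact: orthogonal_mulmx.
  have : O (U^T *m (U *m T)).
    by apply: orthogonal_mulmx => //; exact: orthogonal_trmx.
  by rewrite mulmxA (mulmx1C OU) mul1mx.
rewrite /haar_mean /Rintegral; congr fine.
have := @integral_pushforward _ _ _ _ R _ mU mu O (EFin \o f).
rewrite preO => <-.
- apply: eq_measure_integral => S mS _.
  by have [_ h _] := haar_mu; exact: h.
- exact/measurable_EFinP.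
- apply: (bounded_measurable_integrable (f := fun T => f (U *m T))).
  exact: bounded_measurable_mulmx.
- exact: measurable_orthogonal_group.
Qed.

Lemma lipschitz_bounded_measurable f L :
  measurable_fun setT (f : @borel_mx R n -> R) ->
  (forall T S, O T -> O S -> `|f T - f S| <= L * `|T - S|) ->
  bounded_measurable f.
Proof.
move=> mf fL; split=> //; exists (`|f 1%:M| + `|L| * 2) => T OT.
rewrite -(subrK (f 1%:M) (f T)) (le_trans (ler_normD _ _))// addrC lerD2l.
rewrite (le_trans (fL _ _ OT orthogonal1))//.
rewrite (@le_trans _ _ (`|L| * `|T - 1%:M|)) ?ler_wpM2r ?ler_norm//.
rewrite ler_wpM2l// (le_trans (ler_normB _ _))// (_ : 2 = 1 + 1 :> R)//.
by rewrite lerD// orthogonal_norm_le1//; exact: orthogonal1.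
Qed.

End haar_mean.

(** * Finite quadrature on O(n) *)

Section quadrature.
Context {R : realType} {n : nat} (mu : probability (@borel_mx R n) R).
Hypothesis haar_mu : normalized_haar mu.
Local Notation O := (@orthogonal_group R n).
Implicit Types (f g : 'M[R]_n -> R) (T U S : 'M[R]_n).

(** Half-open cubes of side 1/N. The shift by 1 makes the entries of orthogonal matrices
    nonnegative, so natural numbers can index the cubes. *)
Definition grid_cell N (c : 'M[nat]_n) : set 'M[R]_n :=
  [set T | forall i j, (c i j)%:R <= N%:R * (T i j + 1) < (c i j).+1%:R].

Lemma measurable_grid_cell N c :
  measurable (grid_cell N c : set (@borel_mx R n)).
Proof.
have -> : (grid_cell N c : set (@borel_mx R n)) =
    \bigcap_(ij in [set: 'I_n * 'I_n])
      (setT `&` (fun T : @borel_mx R n => N%:R * ((T : 'M[R]_n) ij.1 ij.2 + 1))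
         @^-1` [set` `[(c ij.1 ij.2)%:R, (c ij.1 ij.2).+1%:R[]).
  apply/seteqP; split => [T hT [i j] _|T h i j] /=.
    by split => //; rewrite in_itv/=; exact: hT.
  by have /= [_] := h (i, j) I; rewrite in_itv.
apply: fin_bigcap_measurable; first exact: finite_finset.
move=> [i j] _ /=.
have : measurable_fun setT (fun T : @borel_mx R n => N%:R * ((T : 'M[R]_n) i j
  + 1)).
  apply: measurable_funM; first exact: measurable_cst.
  by apply: measurable_funD; [exact: measurable_entry|exact: measurable_cst].
by apply => //; exact: measurable_itv.
Qed.

Lemma grid_cell_dist N c T S : (0 < N)%N ->
  grid_cell N c T -> grid_cell N c S -> `|T - S| <= N%:R^-1.
Proof.
move=> N0 hT hS; rewrite [leLHS]/Num.norm/= mx_normrE; apply/bigmax_leP.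
split => [|[i j] _ /=]; first by rewrite invr_ge0.
rewrite !mxE -[leRHS]mul1r ler_pdivlMr ?ltr0n//.
have /andP[a1 a2] := hT i j; have /andP[b1 b2] := hS i j.
rewrite -[X in _ * X]ger0_norm// -normrM ler_norml.
by move: a1 a2 b1 b2; rewrite -!natr1 => *; apply/andP; split; lra.
Qed.

Lemma grid_cell_inj N c d T : grid_cell N c T -> grid_cell N d T -> c = d.
Proof.
move=> hc hd; apply/matrixP => i j.
have /andP[a1 a2] := hc i j; have /andP[b1 b2] := hd i j.
apply/eqP; rewrite eqn_leq -ltnS -[X in _ && X]ltnS -!(ltr_nat R).
by rewrite (le_lt_trans a1 b2) (le_lt_trans b1 a2).
Qed.

(** Each coordinate needs the 2N + 1 indices from 0 to 2N, the last one for entries equal to 1. *)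
Lemma grid_cell_exists N T : `|T| <= 1 ->
  exists c : 'M['I_(N.*2.+1)]_n, grid_cell N (map_mx (@nat_of_ord _) c) T.
Proof.
move=> T1; exists (\matrix_(i, j) inord (Num.truncn (N%:R * (T i j + 1)))).
move=> i j; rewrite !mxE.
have := normr_entry_le T i j => /le_trans/(_ T1);
  rewrite ler_norml => /andP[t1 t2].
have x0 : 0 <= N%:R * (T i j + 1) by rewrite mulr_ge0//; lra.
rewrite inordK.
  exact: truncn_itv.
rewrite ltnS -(ler_nat R); apply: (@le_trans _ _ (N%:R * (T i j + 1))).
  by have /andP[] := truncn_itv x0.
by rewrite -muln2 natrM ler_wpM2l//; lra.
Qed.

(* A bounded linear functional on the space of all bounded functions need not
   commute with integrals; it does commute with the finite sums below, whose
   error is uniform over functions with a common Lipschitz constant. *)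
Lemma quadrature (delta : R) : 0 < delta ->
  exists (J : finType) (w : J -> R) (t : J -> 'M[R]_n),
  [/\ forall j, 0 <= w j, \sum_j w j = 1, forall j, O (t j),
      forall T, O T -> exists j, `|T - t j| <= delta &
      forall f L, 0 <= L -> measurable_fun setT (f : @borel_mx R n -> R) ->
        (forall T S, O T -> O S -> `|f T - f S| <= L * `|T - S|) ->
        `|haar_mean mu f - \sum_j w j * f (t j)| <= L * delta].
Proof.
move=> d0; pose N := (Num.truncn delta^-1).+1.
have Nd : N%:R^-1 <= delta.
  rewrite invf_ple ?posrE ?ltr0n//.
  by rewrite ltW// truncnS_gt.
pose J := 'M['I_(N.*2.+1)]_n; pose cell (j : J) := grid_cell N (map_mx
  (@nat_of_ord _) j).
have cellI (j k : J) T : cell j T -> cell k T -> j = k.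
  move=> hj hk; have /matrixP e := grid_cell_inj hj hk.
  by apply/matrixP => a b; apply: val_inj; have := e a b; rewrite !mxE.
(* A cell that misses O(n) gets the identity as a dummy node in O(n); its weight below is zero. *)
pose t (j : J) := if pselect (exists T, O T /\ cell j T) is left h
  then projT1 (cid h) else 1%:M.
have Ot j : O (t j).
  rewrite /t; case: pselect => [h|_]; last exact: orthogonal1.
  by case: (cid h) => T [].
have tP j T : O T -> cell j T -> cell j (t j).
  rewrite /t; case: pselect => [h|h OT cT]; last by case: h; exists T.
  by case: (cid h) => S [].
have tdist j T : O T -> cell j T -> `|T - t j| <= delta.
  move=> OT cT; apply: le_trans Nd; apply: (grid_cell_dist _ cT) => //.
  exact: tP cT.
have cellE T : O T -> exists j, cell j T.
  by move=> OT; apply: grid_cell_exists; exact: orthogonal_norm_le1.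
pose ind (j : J) (T : 'M[R]_n) : R := \1_(cell j) T.
have bind j : bounded_measurable (ind j).
  split; first by apply: measurable_indic; exact: measurable_grid_cell.
  exists 1 => T _; rewrite /ind indicE; case: (_ \in _) => /=;
    by rewrite ?normr1 ?normr0.
have indE (a : J -> R) T j : cell j T -> \sum_k a k * ind k T = a j.
  move=> cT; rewrite (bigD1 j)//= /ind indicE mem_set// mulr1 big1 ?addr0// =>
    k kj.
  rewrite indicE memNset ?mulr0// => ckT.
  by move/eqP: kj; apply; exact: (cellI _ _ T).
exists J, (fun j => haar_mean mu (ind j)), t; split => //.
- by move=> j; apply: Rintegral_ge0 => T _; rewrite /ind indicE.
- rewrite -haar_mean_sum// -[RHS](haar_mean_cst haar_mu 1).
  apply: eq_haar_mean => T /cellE[j cT].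
  by rewrite -(indE (fun=> 1) T j cT); apply: eq_bigr => k _; rewrite mul1r.
- by move=> T OT; have [j cT] := cellE T OT; exists j; exact: tdist.
move=> f L L0 mf fL.
have bf := lipschitz_bounded_measurable mf fL.
have bt j : bounded_measurable (fun T => f (t j) * ind j T).
  exact: bounded_measurableZ.
(* The sum is the mean of the step function with value f(t_j) on cell j, which is uniformly within L
   delta of f on O(n). *)
have -> : \sum_j haar_mean mu (ind j) * f (t j) =
    haar_mean mu (fun T => \sum_j f (t j) * ind j T).
  rewrite haar_mean_sum//; apply: eq_bigr => j _.
  by rewrite mulrC haar_meanZ.
apply: haar_mean_dist => //; first exact: bounded_measurable_sum.
move=> T OT; have [j cT] := cellE T OT.
rewrite (indE (fun j => f (t j)) T j cT) (le_trans (fL _ _ OT (Ot j)))//.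
by rewrite ler_wpM2l// tdist.
Qed.

End quadrature.

(** * A Lipschitz substitute for the sign *)

Section truncation.
Context {R : realType}.
Implicit Types r s t e : R.

Definition clip r t := Num.max (- r) (Num.min r t).

Lemma normr_clip_le r t : 0 <= r -> `|clip r t| <= r.
Proof.
move=> r0; rewrite ler_norml /clip le_max lexx/= ge_max ge_min lexx/= andbT.
by lra.
Qed.

Lemma clip_lipschitz r s t : `|clip r s - clip r t| <= `|s - t|.
Proof.
have maxL (a b c : R) : `|Num.max a b - Num.max a c| <= `|b - c|.
  have [h1|h1] := leP a b; have [h2|h2] := leP a c;
  by rewrite ler_norml; case: (ger0P (b - c)) => ?; apply/andP; split; lra.
have minL (a b c : R) : `|Num.min a b - Num.min a c| <= `|b - c|.
  have [h1|h1] := leP a b; have [h2|h2] := leP a c;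
  by rewrite ler_norml; case: (ger0P (b - c)) => ?; apply/andP; split; lra.
by rewrite /clip (le_trans (maxL _ _ _)).
Qed.

(** Once |t| >= e r the clipped value is r sgn t and the upper bound is attained. Otherwise the
    product is t^2 / e >= 0, while r |t| <= e r^2. *)
Lemma clip_mul_bounds r t e : 0 <= r -> 0 < e ->
  r * `|t| - e * r ^+ 2 <= clip r (e^-1 * t) * t <= r * `|t|.
Proof.
move=> r0 e0; apply/andP; split; last first.
  rewrite (le_trans (ler_norm _))// normrM ler_wpM2r//.
  exact: normr_clip_le.
have er : 0 <= e * r by rewrite mulr_ge0// ltW.
rewrite /clip; have [ht|ht] := leP r (e^-1 * t).
  rewrite max_r; last by lra.
  have : e * r <= t by rewrite -ler_pdivlMl.
  move=> h; rewrite ger0_norm; last by lra.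
  by rewrite lerBlDr lerDl mulr_ge0 ?sqr_ge0 ?ltW.
have [ht'|ht'] := leP (- r) (e^-1 * t).
  have t1 : t <= e * r by rewrite -ler_pdivrMl// ltW.
  have t2 : - (e * r) <= t by rewrite -mulrN -ler_pdivlMl.
  rewrite (@le_trans _ _ 0)//.
    by rewrite subr_le0 expr2 mulrA mulrC ler_wpM2r// ler_norml t1 t2.
  by rewrite -mulrA mulr_ge0 ?invr_ge0 ?(ltW e0)// -expr2 sqr_ge0.
have t1 : t <= - (e * r) by rewrite -mulrN -ler_pdivrMl// ltW.
rewrite ler0_norm; last by lra.
by rewrite mulrN mulNr lerBlDr lerDl mulr_ge0 ?sqr_ge0 ?ltW.
Qed.

End truncation.

(** * Means over the unit sphere *)

Section sphere_mean.
Context {R : realType} {n : nat} (mu : probability (@borel_mx R n) R).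
Hypothesis haar_mu : normalized_haar mu.
Context (e : 'rV[R]_n).
Hypothesis e1 : l2norm e = 1.
Local Notation O := (@orthogonal_group R n).
Local Notation u T := (e *m (T : 'M[R]_n)^T).
Local Notation mean := (haar_mean mu).
Implicit Types (f g : 'M[R]_n -> R) (T U S : 'M[R]_n) (x z s : 'rV[R]_n).

(** The constants are explicit because one set of quadrature nodes must serve a whole family of
    functions, uniformly in its parameter. *)
Definition regular f M L :=
  [/\ measurable_fun setT (f : @borel_mx R n -> R), 0 <= L,
      forall T, O T -> `|f T| <= M &
      forall T S, O T -> O S -> `|f T - f S| <= L * `|T - S|].

Lemma regular_bounded f M L : regular f M L -> bounded_measurable f.
Proof. by move=> [mf _ fM _]; split => //; exists M. Qed.

Lemma regularW f M L N K : M <= N -> L <= K -> regular f M L -> regular f N K.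
Proof.
move=> MN LK [mf L0 fM fL]; split => //; first exact: le_trans LK.
  by move=> T OT; rewrite (le_trans (fM T OT)).
by move=> T S OT OS; rewrite (le_trans (fL T S OT OS))// ler_wpM2r.
Qed.

Lemma regularD f M L g N K : regular f M L -> regular g N K ->
  regular (fun T => f T + g T) (M + N) (L + K).
Proof.
move=> [mf L0 fM fL] [mg K0 gN gK]; split.
- exact: measurable_funD.
- exact: addr_ge0.
- by move=> T OT; rewrite (le_trans (ler_normD _ _))// lerD ?fM ?gN.
- move=> T S OT OS; rewrite opprD addrACA (le_trans (ler_normD _ _))// mulrDl.
  by rewrite lerD ?fL ?gK.
Qed.

Lemma regularM f M L g N K : regular f M L -> regular g N K ->
  regular (fun T => f T * g T) (M * N) (M * K + N * L).
Proof.
move=> [mf L0 fM fL] [mg K0 gN gK].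
have M0 : 0 <= M by rewrite (le_trans _ (fM _ (orthogonal1)))//.
have N0 : 0 <= N by rewrite (le_trans _ (gN _ (orthogonal1)))//.
split.
- exact: measurable_funM.
- by rewrite addr_ge0// mulr_ge0.
- by move=> T OT; rewrite normrM ler_pM ?fM ?gN.
- move=> T S OT OS.
  have -> : f T * g T - f S * g S = f T * (g T - g S) + g S * (f T - f S) by
    ring.
  rewrite (le_trans (ler_normD _ _))// !normrM mulrDl -!mulrA.
  by rewrite lerD// ler_pM ?fM ?gN ?fL ?gK.
Qed.

Lemma regularZ a f M L : regular f M L ->
  regular (fun T => a * f T) (`|a| * M) (`|a| * L).
Proof.
move=> [mf L0 fM fL]; split.
- by apply: measurable_funM; [exact: measurable_cst|].
- by rewrite mulr_ge0.
- by move=> T OT; rewrite normrM ler_wpM2l ?fM.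
- by move=> T S OT OS; rewrite -mulrBr normrM -mulrA ler_wpM2l ?fL.
Qed.

Lemma sphere_norm T : O T -> l2norm (u T) = 1.
Proof. by move=> OT; rewrite l2norm_orthogonal//; exact: orthogonal_trmx. Qed.

Lemma sphere_lipschitz T S : l2norm (u T - u S) <= n%:R * n%:R * `|T - S|.
Proof.
rewrite -mulmxBr -linearB/= (le_trans (l2norm_mulmx_le _ _))// e1 mulr1 -mulrA.
rewrite !ler_wpM2l// [leLHS]/Num.norm/= mx_normrE.
by apply/bigmax_leP; split => // -[i j] _ /=; rewrite mxE normr_entry_le.
Qed.

Lemma regular_sphere (phi : 'rV[R]_n -> R) M L : 0 <= L ->
  (forall x, l2norm x = 1 -> `|phi x| <= M) ->
  (forall x y, `|phi x - phi y| <= L * l2norm (x - y)) ->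
  regular (fun T => phi (u T)) M (L * (n%:R * n%:R)).
Proof.
move=> L0 phiM phiL.
have lip T S : `|phi (u T) - phi (u S)| <= L * (n%:R * n%:R) * `|T - S|.
  by rewrite (le_trans (phiL _ _))// -mulrA ler_wpM2l// sphere_lipschitz.
split => //.
- apply: (@continuous_measurable_borel_mx _ _ (fun T => phi (u T))).
  exact: (lipschitz_continuous_fun lip).
- by rewrite !mulr_ge0.
- by move=> T OT; apply: phiM; exact: sphere_norm.
Qed.

Lemma regular_dotp x : regular (fun T => dotp (u T) x)
  (l2norm x) (l2norm x * (n%:R * n%:R)).
Proof.
apply: (@regular_sphere (fun y => dotp y x) (l2norm x) (l2norm x));
  first exact: l2norm_ge0.
  by move=> y y1; rewrite (le_trans (normr_dotp_le _ _))// y1 mul1r.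
by move=> y y'; rewrite -dotpBl mulrC normr_dotp_le.
Qed.

Lemma bounded_dotp x : bounded_measurable (fun T => dotp (u T) x).
Proof. exact/regular_bounded/regular_dotp. Qed.

Lemma bounded_normr_dotp x : bounded_measurable (fun T => `|dotp (u T) x|).
Proof.
apply: (regular_bounded (M := l2norm x) (L := l2norm x * (n%:R * n%:R))).
apply: (@regular_sphere (fun y => `|dotp y x|)); first exact: l2norm_ge0.
  by move=> y y1; rewrite normr_id (le_trans (normr_dotp_le _ _))// y1 mul1r.
move=> y y'; rewrite (le_trans (ler_dist_dist _ _))// -dotpBl mulrC.
exact: normr_dotp_le.
Qed.

Lemma sphere_mulmx U T : u (U *m T) = u T *m U^T.
Proof. by rewrite /= trmx_mul mulmxA. Qed.

(** Choose an orthogonal [U] with e U = x; replacing T by U T then turns <u, x> into <u, e>. *)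
Lemma mean_unit (phi : R -> R) x : l2norm x = 1 ->
  bounded_measurable (fun T => phi (dotp (u T) e)) ->
  mean (fun T => phi (dotp (u T) x)) = mean (fun T => phi (dotp (u T) e)).
Proof.
move=> x1 bphi.
have [U OU <-] : exists2 U, O U & e *m U = x.
  by apply: orthogonal_transitive; rewrite e1.
rewrite -(haar_mean_mulmx haar_mu OU bphi); apply: eq_haar_mean => T OT.
by rewrite sphere_mulmx [in RHS]dotp_mulmxl trmxK.
Qed.

(** The kappa of the overview. *)
Definition mean_abs_coord : R := mean (fun T => `|dotp (u T) e|).
Local Notation kappa := mean_abs_coord.

Lemma mean_abs_dotp x : mean (fun T => `|dotp (u T) x|) = kappa * l2norm x.
Proof.
have [->|x0] := eqVneq x 0.
  rewrite l2norm0 mulr0 -(haar_mean_cst haar_mu 0); apply: eq_haar_mean => T _.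
  by rewrite dotp0r normr0.
have -> : mean (fun T => `|dotp (u T) x|) =
    mean (fun T => l2norm x * `|dotp (u T) ((l2norm x)^-1 *: x)|).
  apply: eq_haar_mean => T _; rewrite dotpZr normrM ger0_norm ?invr_ge0
    ?l2norm_ge0//.
  rewrite mulrA divff ?mul1r//.
  by apply: contra_neq x0 => /l2norm_eq0.
rewrite haar_meanZ 1?mulrC; last exact: bounded_normr_dotp.
congr (_ * _); apply: (mean_unit (phi := fun t => `|t|));
  first exact: l2norm_unit.
exact: bounded_normr_dotp.
Qed.

Lemma mean_dotp_sqr x : mean (fun T => dotp (u T) x ^+ 2) = dotp x x / n%:R.
Proof.
have bq y : bounded_measurable (fun T => dotp (u T) y ^+ 2).
  by under eq_fun do rewrite expr2; apply: bounded_measurableM;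
    exact: bounded_dotp.
pose q := mean (fun T => dotp (u T) e ^+ 2).
have qE y : l2norm y = 1 -> mean (fun T => dotp (u T) y ^+ 2) = q.
  by move=> y1; apply: (mean_unit (phi := fun t => t ^+ 2)).
(* The n squared coordinates of a unit vector have equal means and sum to 1; in particular n is not
   0. *)
have nq : n%:R * q = 1.
  rewrite -[RHS](haar_mean_cst haar_mu).
  have -> : mean (fun=> 1) = mean (fun T => \sum_i dotp (u T) (delta_mx 0 i) ^+
    2).
    apply: eq_haar_mean => T OT; rewrite -(expr1n _ 2) -(sphere_norm OT).
    by rewrite l2norm_sqr; apply: eq_bigr => i _; rewrite dotp_delta expr2.
  rewrite haar_mean_sum// (eq_bigr (fun=> q)).
    by rewrite sumr_const card_ord mulr_natl.
  by move=> i _; apply: qE; rewrite /l2norm dotp_delta mxE !eqxx sqrtr1.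
have n0 : n%:R != 0 :> R.
  by apply/eqP => n0; move: nq; rewrite n0 mul0r => /esym/eqP; rewrite oner_eq0.
have {nq}qV : q = n%:R^-1 by rewrite -[RHS]mulr1 -[X in _ = _ * X]nq mulKf.
have [->|x0] := eqVneq x 0.
  rewrite dotp0l mul0r -(haar_mean_cst haar_mu 0); apply: eq_haar_mean => T _.
  by rewrite dotp0r expr0n.
have x1 : l2norm x != 0 by apply: contra_neq x0 => /l2norm_eq0.
have -> : mean (fun T => dotp (u T) x ^+ 2) =
    mean (fun T => l2norm x ^+ 2 * dotp (u T) ((l2norm x)^-1 *: x) ^+ 2).
  apply: eq_haar_mean => T _; rewrite dotpZr exprMn mulrA -exprMn divff//.
  by rewrite expr1n mul1r.
by rewrite haar_meanZ// qE ?l2norm_unit// qV l2norm_sqr.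
Qed.

(** Polarization of [mean_dotp_sqr]. *)
Lemma mean_dotp_mul x z :
  mean (fun T => dotp (u T) x * dotp (u T) z) = dotp x z / n%:R.
Proof.
have bq y : bounded_measurable (fun T => dotp (u T) y ^+ 2).
  by under eq_fun do rewrite expr2; apply: bounded_measurableM;
    exact: bounded_dotp.
have -> : mean (fun T => dotp (u T) x * dotp (u T) z) =
    mean (fun T => 2^-1 * dotp (u T) (x + z) ^+ 2 +
      ((- 2^-1) * dotp (u T) x ^+ 2 + (- 2^-1) * dotp (u T) z ^+ 2)).
  by apply: eq_haar_mean => T _; rewrite dotpDr; field.
rewrite !haar_meanD//; try by [do ?apply: bounded_measurableD;
  apply: bounded_measurableZ].
rewrite !haar_meanZ// !mean_dotp_sqr !dotpDl !dotpDr (dotpC z x).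
by set k := n%:R^-1; field.
Qed.

(** The mean of phi(<u,s>) u is parallel to s: the reflection along a vector y orthogonal to s fixes
    <u,s> and reverses <u,y>. Multiplying through by <s,s> avoids a division. *)
Lemma mean_dotp_parallel (phi : R -> R) s z :
  bounded_measurable (fun T => phi (dotp (u T) s)) ->
  dotp s s * mean (fun T => phi (dotp (u T) s) * dotp (u T) z) =
  dotp s z * mean (fun T => phi (dotp (u T) s) * dotp (u T) s).
Proof.
move=> bphi.
have bz y : bounded_measurable (fun T => phi (dotp (u T) s) * dotp (u T) y).
  by apply: bounded_measurableM => //; exact: bounded_dotp.
pose y := dotp s s *: z - dotp s z *: s.
have sy : dotp s y = 0 by rewrite dotpBr !dotpZr mulrC subrr.
apply/eqP; rewrite -subr_eq0 -!haar_meanZ//.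
rewrite -[X in _ + X]mulN1r -haar_meanZ; last exact: bounded_measurableZ.
rewrite -haar_meanD; [|exact: bounded_measurableZ|by do 2!apply:
  bounded_measurableZ].
have -> : mean (fun T => dotp s s * (phi (dotp (u T) s) * dotp (u T) z) +
      -1 * (dotp s z * (phi (dotp (u T) s) * dotp (u T) s))) =
    mean (fun T => phi (dotp (u T) s) * dotp (u T) y).
  by apply: eq_haar_mean => T _; rewrite dotpBr !dotpZr; ring.
have [->|y0] := eqVneq y 0.
  apply/eqP; rewrite -[RHS](haar_mean_cst haar_mu); apply: eq_haar_mean => T _.
  by rewrite dotp0r mulr0.
have Or := reflection_orthogonal y0.
have yy0 : dotp y y != 0 by apply: contra_neq y0 => /dotp_eq0.
have := haar_mean_mulmx haar_mu Or (bz y).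
have -> : mean (fun T => phi (dotp (u (reflection y *m T)) s) *
      dotp (u (reflection y *m T)) y) =
    mean (fun T => -1 * (phi (dotp (u T) s) * dotp (u T) y)).
  apply: eq_haar_mean => T _; rewrite sphere_mulmx !(dotp_mulmxl (e *m T^T))
    trmxK.
  rewrite !mul_reflection sy mulr0 mul0r scale0r subr0.
  by rewrite -mulrA divff// mulr1 dotpBr dotpZr; ring.
rewrite haar_meanZ// => h; apply/eqP; lra.
Qed.

Lemma regular_clip s eps : 0 < eps -> l2norm s <= 1 ->
  regular (fun T => clip (l2norm s) (eps^-1 * dotp (u T) s)) 1 (eps^-1 * (n%:R
    * n%:R)).
Proof.
move=> eps0 s1.
apply: (@regular_sphere (fun y => clip (l2norm s) (eps^-1 * dotp y s))).
- by rewrite invr_ge0 ltW.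
- by move=> x _; rewrite (le_trans (normr_clip_le _ _))// l2norm_ge0.
move=> x y; rewrite (le_trans (clip_lipschitz _ _ _))//.
rewrite -mulrBr -dotpBl normrM ger0_norm ?invr_ge0 ?(ltW eps0)//.
rewrite ler_wpM2l ?invr_ge0 ?(ltW eps0)// (le_trans (normr_dotp_le _ _))//.
by rewrite ler_piMr ?l2norm_ge0.
Qed.

(* [clip |s| (<u,s> / eps)] is a Lipschitz substitute for [|s| sgn <u,s>], whose
   mean against [<u,z>] is exactly [kappa <s,z>]. *)
Lemma mean_clip s z eps : 0 < eps -> l2norm s <= 1 ->
  `|mean (fun T => clip (l2norm s) (eps^-1 * dotp (u T) s) * dotp (u T) z)
    - kappa * dotp s z| <= eps * `|dotp s z|.
Proof.
move=> eps0 s1; have [->|s0] := eqVneq s 0.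
  rewrite dotp0l normr0 !mulr0 subr0 -[X in mean X](_ : (fun=> 0) = _).
    by rewrite haar_mean_cst// normr0.
  apply/funext => T; have := @normr_clip_le R (l2norm (0 : 'rV[R]_n)) (eps^-1 *
    dotp (u T) 0) (l2norm_ge0 _).
  by rewrite l2norm0 normr_le0 => /eqP ->; rewrite mul0r.
have bc := regular_bounded (regular_clip eps0 s1).
have ss : 0 < dotp s s.
  by rewrite lt_def dotp_ge0 andbT; apply: contra_neq s0 => /dotp_eq0.
have := mean_dotp_parallel (phi := fun t => clip (l2norm s) (eps^-1 * t)) z bc.
set A := mean _; set B := mean _ => AB.
have bs := bounded_dotp s.
(* [B] is the case z = s, where [clip_mul_bounds] compares the integrand with |s| |<u,s>|, whose
   mean is kappa <s,s>. *)
have Bu : B <= kappa * dotp s s.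
  rewrite -l2norm_sqr expr2 mulrA -mean_abs_dotp mulrC -haar_meanZ;
    last exact: bounded_normr_dotp.
  apply: haar_mean_le; [exact:
    bounded_measurableM|exact/bounded_measurableZ/bounded_normr_dotp|].
  by move=> T _; have /andP[] := clip_mul_bounds (dotp (u T) s) (l2norm_ge0 s)
    eps0.
have Bl : kappa * dotp s s - eps * dotp s s <= B.
  rewrite -l2norm_sqr [X in kappa * X]expr2 mulrA -mean_abs_dotp mulrC
    -haar_meanZ; last exact: bounded_normr_dotp.
  rewrite -(haar_mean_cst haar_mu (eps * _)) -mulN1r -haar_meanZ;
    last exact: bounded_measurable_cst.
  have b1 : bounded_measurable (fun T => l2norm s * `|dotp (u T) s|).
    exact/bounded_measurableZ/bounded_normr_dotp.
  have b2 : bounded_measurable (fun T : 'M[R]_n => -1 * (eps * l2norm s ^+ 2)).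
    exact: bounded_measurable_cst.
  rewrite -haar_meanD//.
  apply: haar_mean_le; [exact: bounded_measurableD|exact: bounded_measurableM|].
  by move=> T _; have /andP[] := clip_mul_bounds (dotp (u T) s) (l2norm_ge0 s)
    eps0; rewrite mulN1r.
(* By parallelism the relative error found for z = s is the same for every z. *)
have -> : A - kappa * dotp s z = (B / dotp s s - kappa) * dotp s z.
  have -> : A = dotp s z * B / dotp s s.
    by rewrite -AB mulrAC divff ?mul1r// gt_eqF.
  by rewrite mulrBl; congr (_ - _); ring.
rewrite normrM ler_wpM2r// ler_norml; apply/andP; split.
  by rewrite lerBrDr ler_pdivlMr// mulrDl addrC mulNr.
by rewrite lerBlDr ler_pdivrMr// (le_trans Bu)// ler_pM2r// lerDr ltW.
Qed.

End sphere_mean.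

(** * The Hahn-Banach theorem for norm-dominated functionals *)

Section hahn_banach.
Context {R : realType} {V : normedModType R}.
Implicit Types (G : set (V * R)) (v w : V) (r s a : R).

(** Partial functionals are encoded as graphs, so extension is inclusion and chains have unions.
    Single-valuedness follows from linearity and domination: (0, r) and (0, -r) in G give r = 0. *)
Definition dominated_linear_graph G :=
  [/\ G (0, 0),
      forall a v r w s, G (v, r) -> G (w, s) -> G (a *: v + w, a * r + s) &
      forall v r, G (v, r) -> r <= `|v|].

Lemma dominated_linear_graph_scale G a v r : dominated_linear_graph G ->
  G (v, r) -> G (a *: v, a * r).
Proof.
move=> [G0 Glin _] vr; rewrite -(addr0 (a *: v)) -(addr0 (a * r)).
exact: Glin.
Qed.

Lemma dominated_linear_graph_extend G v0 : dominated_linear_graph G ->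
  exists G', [/\ dominated_linear_graph G', G `<=` G' & exists r, G' (v0, r)].
Proof.
move=> hG; have [G0 Glin Gdom] := hG.
(* The lower constraints on the value at [v0]. By the triangle inequality they lie below all the
   upper ones |w + v0| - s, so the supremum is an admissible value. *)
pose D := [set wr.2 - `|wr.1 - v0| | wr in G].
have ubD w s : G (w, s) -> ubound D (`|w + v0| - s).
  move=> ws _ [[w' s'] /= ws' <-]; rewrite lerBrDr addrAC lerBlDr.
  have := Glin 1 _ _ _ _ ws ws'; rewrite scale1r mul1r => /Gdom h.
  rewrite addrC (le_trans h)// (_ : w + w' = (w + v0) + (w' - v0)).
    exact: ler_normD.
  by rewrite addrACA subrr addr0.
have Dne : D !=set0 by exists (0 - `|0 - v0|), (0, 0).
have hasD : has_sup D by split => //; exists (`|0 + v0| - 0); exact: ubD.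
pose al := sup D.
have up w s : G (w, s) -> s + al <= `|w + v0|.
  by move=> ws; rewrite addrC -lerBrDr; apply: ge_sup => //; exact: ubD.
have dn w s : G (w, s) -> s - al <= `|w - v0|.
  move=> ws; rewrite lerBlDl -lerBlDr; apply: ub_le_sup; last by exists (w, s).
  by case: hasD.
exists [set x | exists w s t, [/\ G (w, s),
  x.1 = w + t *: v0 & x.2 = s + t * al]].
split.
- split.
  + by exists 0, 0, 0; rewrite scale0r mul0r !addr0.
  + move=> a v r w s [w1 [s1 [t1 [g1 /= -> ->]]]] [w2 [s2 [t2 [g2 /= -> ->]]]].
    exists (a *: w1 + w2), (a * s1 + s2), (a * t1 + t2); split.
    * exact: Glin.
    * by rewrite /= scalerDr scalerA scalerDl addrACA.
    * by rewrite /=; ring.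
  + move=> v r [w [s [t [g /= -> ->]]]].
    (* Dividing by |t| reduces to the coefficients 1 and -1, that is, to [up] and [dn]. *)
    have [t0|t0|->] := ltgtP t 0; last by rewrite scale0r mul0r !addr0;
      exact: Gdom.
      have := dn _ _ (dominated_linear_graph_scale (- t)^-1 hG g).
      have nt : 0 < - t by rewrite oppr_gt0.
      rewrite -(ler_pM2l nt) mulrBr mulrA divff ?gt_eqF// mul1r mulNr opprK.
      move=> /le_trans; apply; rewrite -{1}(gtr0_norm nt) -normrZ scalerBr
        scalerA.
      by rewrite divff ?gt_eqF// scale1r scaleNr opprK.
    have := up _ _ (dominated_linear_graph_scale t^-1 hG g).
    rewrite -(ler_pM2l t0) mulrDr mulrA divff ?gt_eqF// mul1r.
    move=> /le_trans; apply; rewrite -{1}(gtr0_norm t0) -normrZ scalerDr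
      scalerA.
    by rewrite divff ?gt_eqF// scale1r.
- by move=> [w s] g; exists w, s, 0; rewrite scale0r mul0r !addr0.
- by exists al, 0, 0, 1; rewrite scale1r mul1r !add0r.
Qed.

Lemma dominated_linear_graph_maximal G : dominated_linear_graph G ->
  exists G', [/\ dominated_linear_graph G', G `<=` G' &
    forall v, exists r, G' (v, r)].
Proof.
move=> hG.
(* Joining [G] to every member keeps the hypothesis of Zorn's lemma true for
   the empty chain. *)
have chain (F : set (set (V * R))) :
    F `<=` [set A | dominated_linear_graph (A `|` G)] -> total_on F subset ->
    dominated_linear_graph ((\bigcup_(X in F) X) `|` G).
  move=> FP Ftot; have [G0 Glin Gdom] := hG; split; first by right.
  - move=> a v r w s [[A FA Avr]|gvr] [[B FB Bws]|gws].
    + have [AB|BA] := Ftot A B FA FB.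
        have [_ /(_ a v r w s) h _] := FP _ FB.
        by case: h => [||h|h]; [left; exact: AB|left|left; exists B|right].
      have [_ /(_ a v r w s) h _] := FP _ FA.
      by case: h => [||h|h]; [left|left; exact: BA|left; exists A|right].
    + have [_ /(_ a v r w s) h _] := FP _ FA.
      by case: h => [||h|h]; [left|right|left; exists A|right].
    + have [_ /(_ a v r w s) h _] := FP _ FB.
      by case: h => [||h|h]; [right|left|left; exists B|right].
    + by right; exact: Glin.
  - move=> v r [[A FA Avr]|/Gdom//].
    by have [_ _] := FP _ FA; apply; left.
have [A [hA Amax]] := Zorn_bigcup chain.
exists (A `|` G); split; [by []|by move=> x; right|move=> v].
have [G' [hG' AG' [r vr]]] := dominated_linear_graph_extend v hA.
exists r; apply: contrapT => nvr.
have AG'' : A `<=` G' by move=> x Ax; apply: AG'; left.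
have : A `<` G'.
  by split=> // G'A; apply: nvr; left; exact: G'A.
move=> /Amax; apply; rewrite /=.
rewrite (_ : G' `|` G = G')//; apply/setUidPl => x Gx.
by apply: AG'; right.
Qed.

(** The functional lives on the image of [i]; the bound on [g] makes it well defined there. *)
Lemma hahn_banach (U : lmodType R) (i : {linear U -> V}) (g : U -> R) :
  (forall a x y, g (a *: x + y) = a * g x + g y) ->
  (forall x, g x <= `|i x|) ->
  exists f : V -> R,
    [/\ forall a v w, f (a *: v + w) = a * f v + f w,
        forall v, f v <= `|v| & forall x, f (i x) = g x].
Proof.
move=> glin gi.
have hG : dominated_linear_graph [set p | exists x, p = (i x, g x)].
  split.
  - exists 0; rewrite linear0; congr (_, _).
    by have := glin (-1) 0 0; rewrite scaler0 addr0 mulN1r addNr.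
  - move=> a v r w s [x [-> ->]] [y [-> ->]]; exists (a *: x + y).
    by rewrite linearP glin.
  - by move=> v r [x [-> ->]].
have [G' [[G0 Glin Gdom] GG' tot]] := dominated_linear_graph_maximal hG.
have uniq v r s : G' (v, r) -> G' (v, s) -> r = s.
  have le_rs p q : G' (v, p) -> G' (v, q) -> p <= q.
    move=> vp vq; have := Glin (-1) _ _ _ _ vq vp.
    by rewrite scaleN1r addNr mulN1r => /Gdom; rewrite normr0 addrC subr_le0.
  by move=> vr vs; apply/eqP; rewrite eq_le !le_rs.
pose f v := projT1 (cid (tot v)).
have fG v : G' (v, f v) by rewrite /f; case: cid.
exists f; split.
- by move=> a v w; apply: (uniq (a *: v + w)); [exact: fG|exact: Glin].
- by move=> v; exact: Gdom.
- by move=> x; apply: (uniq (i x)) => //; apply: GG'; exists x.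
Qed.

End hahn_banach.

(** * Upper bound for the absolute projection constant *)

Lemma unitmx_injective (F : fieldType) n (M : 'M[F]_n) :
  (forall x : 'rV_n, x *m M = 0 -> x = 0) -> M \in unitmx.
Proof.
move=> inj; rewrite -row_free_unit -kermx_eq0; apply/eqP/row_matrixP => i.
by rewrite row0; apply: inj; rewrite -row_mul mulmx_ker row0.
Qed.

Section projection_constant.
Context {R : realType} {n : nat} (mu : probability (@borel_mx R n) R).
Hypothesis haar_mu : normalized_haar mu.
Context (e : 'rV[R]_n).
Hypothesis e1 : l2norm e = 1.
Local Notation O := (@orthogonal_group R n).
Local Notation u T := (e *m (T : 'M[R]_n)^T).
Local Notation kappa := (mean_abs_coord mu e).

Lemma mean_abs_coord_ge0 : 0 <= kappa.
Proof. by apply: Rintegral_ge0 => T _; exact: normr_ge0. Qed.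

(* The exact averaged operator y |-> n mean (zeta_u(y) u), with zeta_u a
   norm-one extension of <u, .>, would need zeta_u to be measurable in u. Its
   finite sum version is only close to the identity on the image of [i], hence
   the correction by [invmx]. *)
Lemma projection_bound_approx (eta : R) : 0 < eta < 1 ->
  projection_bound (@l2norm R n) ((n%:R * kappa + eta) / (1 - eta)).
Proof.
move=> /andP[eta0 eta1] Y i iN.
pose C : R := n%:R * n%:R.
have C0 : 0 <= C by rewrite mulr_ge0.
(* The product <u,x> <u,d> has Lipschitz constant 2 C |x| |d| in T, and the sums carry a factor n;
   the summand 1 keeps the denominator positive. *)
pose delta := eta / (n%:R * (2 * C) + 1).
have den0 : 0 < n%:R * (2 * C) + 1 by rewrite ltr_wpDl// !mulr_ge0.
have delta0 : 0 < delta by rewrite divr_gt0.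
have ndelta : n%:R * (2 * C) * delta <= eta.
  by rewrite /delta mulrCA ler_piMr ?(ltW eta0)// ler_pdivrMr// mul1r lerDl.
have [J [w [t [w0 w1 Ot _ quad]]]] := quadrature haar_mu delta0.
have ut1 j : l2norm (u (t j)) = 1 by exact: sphere_norm.
have ext j : exists f : Y -> R,
    [/\ forall a v y, f (a *: v + y) = a * f v + f y,
        forall v, f v <= `|v| & forall x, f (i x) = dotp (u (t j)) x].
  apply: hahn_banach => [a x y|x]; first by rewrite dotpDr dotpZr.
  by rewrite iN (le_trans (dotp_le _ _))// ut1 mul1r.
pose z j := projT1 (cid (ext j)).
have zlin j a v y : z j (a *: v + y) = a * z j v + z j y.
  by rewrite /z; case: cid => f [].
have zN j v : `|z j v| <= `|v|.
  have zle y : z j y <= `|y| by rewrite /z; case: cid => f [].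
  have zm : z j (- v) = - z j v.
    have z0 : z j 0 = 0.
      by have := zlin j (-1) 0 0; rewrite scaler0 addr0 mulN1r addNr.
    by have := zlin j (-1) v 0; rewrite scaleN1r addr0 mulN1r z0 addr0.
  by rewrite ler_norml zle andbT lerNl -zm -(normrN v) zle.
have zi j x : z j (i x) = dotp (u (t j)) x by rewrite /z; case: cid => f [].
pose L (y : Y) : 'rV[R]_n := \sum_j (n%:R * (w j * z j y)) *: u (t j).
have Llin a v y : L (a *: v + y) = a *: L v + L y.
  rewrite /L scaler_sumr -big_split/=; apply: eq_bigr => j _.
  by rewrite zlin scalerA -scalerDl; congr (_ *: _); ring.
have dotL y x : dotp (L y) x = n%:R * \sum_j w j * (z j y * dotp (u (t j)) x).
  rewrite dotp_suml mulr_sumr; apply: eq_bigr => j _.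
  by rewrite dotpZl !mulrA.
(* Tested against d = L(i x) - x itself, using that <u,x> <u,d> has mean <x,d> / n. *)
have Li x : l2norm (L (i x) - x) <= eta * l2norm x.
  set d := L (i x) - x.
  have [d0|d0] := eqVneq (l2norm d) 0.
    by rewrite d0 mulr_ge0 ?l2norm_ge0// ltW.
  have dp : 0 < l2norm d by rewrite lt_def d0 l2norm_ge0.
  rewrite -(ler_pM2r dp) -expr2 l2norm_sqr {1}/d dotpBl dotL.
  have reg := regularM (regular_dotp e1 x) (regular_dotp e1 d).
  have [mreg Lreg _ lreg] := reg.
  have := quad _ _ Lreg mreg lreg; rewrite mean_dotp_mul// => h.
  under eq_bigr do rewrite zi.
  have [n0|n0] := eqVneq n 0%N.
    suff : d = 0 by move=> dd; move: d0; rewrite dd l2norm0 eqxx.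
    by move: (d); rewrite n0 => q; rewrite thinmx0.
  have n0' : 0 < n%:R :> R by rewrite ltr0n lt0n.
  set S := \sum_j _ in h *.
  have -> : n%:R * S - dotp x d = - (n%:R * (dotp x d / n%:R - S)).
    by rewrite mulrBr mulrCA divff ?mulr1 ?opprB// gt_eqF.
  rewrite (le_trans (ler_norm _))// normrN normrM gtr0_norm//.
  rewrite (@le_trans _ _ (n%:R * (2 * C) * delta * (l2norm x * l2norm d)))//.
    rewrite -!(mulrA n%:R) ler_wpM2l// (le_trans h)// /C le_eqVlt; apply/orP;
      left.
    by apply/eqP; ring.
  by rewrite -[leRHS]mulrA ler_wpM2r// mulr_ge0 ?l2norm_ge0.
(* Tested against L y: since |z_j(y)| <= |y|, the square |L y|^2 is at most n |y| times the
   quadrature sum of |<u, L y>|, which is close to kappa |L y|. *)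
have LN y : l2norm (L y) <= (n%:R * kappa + eta) * `|y|.
  have [d0|d0] := eqVneq (l2norm (L y)) 0.
    by rewrite d0 mulr_ge0// addr_ge0 ?(ltW eta0)// mulr_ge0
      ?mean_abs_coord_ge0.
  have dp : 0 < l2norm (L y) by rewrite lt_def d0 l2norm_ge0.
  rewrite -(ler_pM2r dp) -expr2 l2norm_sqr dotL.
  have reg : regular (fun T => `|dotp (u T) (L y)|) (l2norm (L y)) (l2norm (L
    y) * C).
    apply: (@regular_sphere _ _ _ e1 (fun x => `|dotp x (L y)|));
      first exact: l2norm_ge0.
      by move=> x x1; rewrite normr_id (le_trans (normr_dotp_le _ _))// x1
        mul1r.
    move=> x x'; rewrite (le_trans (ler_dist_dist _ _))// -dotpBl mulrC.
    exact: normr_dotp_le.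
  have [mreg Lreg _ lreg] := reg.
  have := quad _ _ Lreg mreg lreg; rewrite mean_abs_dotp//.
  set S := \sum_j w j * `|_|; rewrite ler_norml => /andP[h _].
  have {}h : S <= (kappa + C * delta) * l2norm (L y) by lra.
  rewrite (@le_trans _ _ (n%:R * (`|y| * S)))//.
    rewrite ler_wpM2l// mulr_sumr; apply: ler_sum => j _.
    rewrite [leRHS]mulrCA ler_wpM2l// (le_trans (ler_norm _))// normrM.
    by rewrite ler_wpM2r.
  rewrite (@le_trans _ _ (n%:R * (`|y| * ((kappa + C * delta) * l2norm (L
    y)))))//.
    by rewrite ler_wpM2l// ler_wpM2l.
  rewrite (_ : _ * (_ * _) = (n%:R * kappa + n%:R * C * delta) * `|y| * l2norm
    (L y)); last by ring.
  rewrite ler_wpM2r ?l2norm_ge0// ler_wpM2r// lerD2l (le_trans _ ndelta)//.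
  by rewrite ler_wpM2r ?(ltW delta0)// ler_wpM2l//; lra.
have Lilin : linear (fun x => L (i x)) by move=> a x y; rewrite linearP Llin.
pose Li' : {linear 'rV[R]_n -> 'rV[R]_n} :=
  HB.pack (fun x => L (i x)) (GRing.isLinear.Build _ _ _ _ (fun x => L (i x))
    Lilin).
pose M := lin1_mx Li'.
have LM x : x *m M = L (i x) by rewrite mul_rV_lin1.
(* A vector in the kernel satisfies |x| <= eta |x| with eta < 1. *)
have Mu : M \in unitmx.
  apply: unitmx_injective => x xM0; have := Li x.
  rewrite -LM xM0 sub0r l2normN -subr_ge0 -{2}(mul1r (l2norm x)) -mulrBl.
  rewrite nmulr_rge0 ?subr_lt0// => x0; apply: l2norm_eq0.
  by apply/eqP; rewrite eq_le x0 l2norm_ge0.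
pose Q (y : Y) : 'rV[R]_n := L y *m invmx M.
have Qlin : linear Q by move=> a v y; rewrite /Q Llin mulmxDl scalemxAl.
have Qi x : Q (i x) = x by rewrite /Q -LM mulmxK.
pose P y := i (Q y).
have Plin : linear P by move=> a v y; rewrite /P Qlin linearP.
pose P' : {linear Y -> Y} := HB.pack P (GRing.isLinear.Build _ _ _ _ P Plin).
(* As L y = L(i(Q y)), one has |Q y| <= |L y| + eta |Q y|, whence the factor 1 / (1 - eta). *)
have PN y : `|P y| <= (n%:R * kappa + eta) / (1 - eta) * `|y|.
  rewrite /P iN mulrAC ler_pdivlMr ?subr_gt0// (le_trans _ (LN y))//.
  rewrite mulrBr mulr1 lerBlDr mulrC.
  have -> : L y = L (i (Q y)) by rewrite -LM /Q mulmxKV.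
  rewrite -{1}(subrK (L (i (Q y))) (Q y)) (le_trans (l2normD _ _))// addrC
    lerD2l.
  by rewrite -l2normN opprB Li.
exists P' => //; split.
- apply: (@lipschitz_continuous_fun _ _ _ _ ((n%:R * kappa + eta) / (1 - eta)))
  => x y.
  by rewrite -linearB PN.
- apply/seteqP; split => [_ [y _ <-]|_ [x _ <-]]; first by exists (Q y).
  by exists (i x) => //; rewrite /= /P Qi.
- by move=> x; rewrite /= /P Qi.
Qed.

Lemma absolute_projection_constant_le c :
  absolute_projection_constant (@l2norm R n) c -> c <= n%:R * kappa.
Proof.
move=> [c0 _ cmin]; apply/ler_addgt0Pr => eps eps0.
(* Clearing the denominator gives c <= n kappa + eta (1 + c). *)
pose eta := Num.min 2^-1 (eps / (1 + c)).
have c1 : 0 < 1 + c by rewrite addr_gt0.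
have eta0 : 0 < eta by rewrite lt_min divr_gt0// andbT invr_gt0.
have eta1 : eta < 1 by rewrite gt_min; apply/orP; left; lra.
have nk : 0 <= n%:R * kappa by rewrite mulr_ge0 ?mean_abs_coord_ge0.
have : c <= (n%:R * kappa + eta) / (1 - eta).
  apply: cmin; first by rewrite divr_gt0 ?subr_gt0// ltr_wpDl.
  by apply: projection_bound_approx; rewrite eta0.
rewrite ler_pdivlMr ?subr_gt0// => h.
have : eta * (1 + c) <= eps by rewrite -ler_pdivlMr// ge_min lexx orbT.
lra.
Qed.

End projection_constant.

(** * The Banach space of bounded functions on a set *)

Section bounded_functions.
Context (R : realType) (X : Type).
Implicit Types f g : X -> R.

Definition bounded_pred : {pred X -> R} :=
  [pred f | `[< exists M : R, forall x, `|f x| <= M >]].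

Lemma bounded_submod_closed : submod_closed bounded_pred.
Proof.
split; first by apply/asboolP; exists 0 => x; rewrite /= normr0.
move=> a f g /asboolP[M fM] /asboolP[N gN]; apply/asboolP.
exists (`|a| * M + N) => x; rewrite (le_trans (ler_normD _ _))//.
by rewrite normrM lerD// ler_wpM2l.
Qed.

HB.instance Definition _ :=
  GRing.isSubmodClosed.Build R (X -> R) bounded_pred bounded_submod_closed.

Record bfun := BFun { bfun_val :> X -> R; _ : bfun_val \in bounded_pred }.

HB.instance Definition _ := [isSub for bfun_val].
HB.instance Definition _ := gen_eqMixin bfun.
HB.instance Definition _ := gen_choiceMixin bfun.
HB.instance Definition _ := [SubChoice_isSubLmodule of bfun by <:].

Implicit Types h k : bfun.

Definition sup_norm h : R := sup [set `|h x| | x in [set: X]].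

Lemma bfun_bounded h : exists M : R, forall x, `|h x| <= M.
Proof. by case: h => f fb; have /asboolP := fb. Qed.

Lemma sup_norm_ge h x : `|h x| <= sup_norm h.
Proof.
have [M hM] := bfun_bounded h.
by apply: ub_le_sup; [exists M => _ [y _ <-]; exact: hM|exists x].
Qed.

(** [0 <= B] covers an empty [X], for which the supremum is 0 by convention. *)
Lemma sup_norm_le h B : 0 <= B -> (forall x, `|h x| <= B) -> sup_norm h <= B.
Proof.
move=> B0 hB; have [[x _]|X0] := pselect ([set: X] !=set0).
  by apply: ge_sup; [exists `|h x|, x|move=> _ [y _ <-]; exact: hB].
rewrite /sup_norm (_ : [set _ | _ in _] = set0) ?sup0//.
by apply/seteqP; split => // y [x _ _]; case: X0; exists x.
Qed.

Lemma sup_norm_ge0 h : 0 <= sup_norm h.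
Proof.
have [[x _]|X0] := pselect ([set: X] !=set0).
  exact: le_trans (normr_ge0 (h x)) (sup_norm_ge h x).
rewrite /sup_norm (_ : [set _ | _ in _] = set0) ?sup0//.
by apply/seteqP; split => // y [x _ _]; case: X0; exists x.
Qed.

Lemma bfunDE h k x : (h + k) x = h x + k x. Proof. by []. Qed.

Lemma bfunZE a h x : (a *: h) x = a * h x. Proof. by []. Qed.

Lemma sup_normD h k : sup_norm (h + k) <= sup_norm h + sup_norm k.
Proof.
apply: sup_norm_le => [|x]; first by rewrite addr_ge0// sup_norm_ge0.
by rewrite bfunDE (le_trans (ler_normD _ _))// lerD// sup_norm_ge.
Qed.

Lemma bfunP h k : (forall x, h x = k x) -> h = k.
Proof. by move=> hk; apply: val_inj; apply/funext. Qed.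

Lemma sup_norm_eq0 h : sup_norm h = 0 -> h = 0.
Proof.
by move=> h0; apply: bfunP => x; apply/eqP; rewrite -normr_le0 -h0 sup_norm_ge.
Qed.

Lemma sup_normZ a h : sup_norm (a *: h) = `|a| * sup_norm h.
Proof.
have [->|a0] := eqVneq a 0.
  rewrite scale0r normr0 mul0r; apply/eqP; rewrite eq_le sup_norm_ge0 andbT.
  by apply: sup_norm_le => // x; rewrite normr0.
have an0 : 0 < `|a| by rewrite normr_gt0.
apply/eqP; rewrite eq_le; apply/andP; split.
  apply: sup_norm_le => [|x]; first by rewrite mulr_ge0// sup_norm_ge0.
  by rewrite bfunZE normrM ler_wpM2l// sup_norm_ge.
rewrite -ler_pdivlMl//; apply: sup_norm_le => [|x].
  by rewrite mulr_ge0 ?invr_ge0// sup_norm_ge0.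
by rewrite ler_pdivlMl// -normrM -bfunZE sup_norm_ge.
Qed.

HB.instance Definition _ :=
  Lmodule_isNormed.Build R bfun sup_normD sup_normZ sup_norm_eq0.

Lemma bfun_norm_ge h x : `|h x| <= `|h|.
Proof. exact: sup_norm_ge. Qed.

Lemma bfun_norm_le h B : 0 <= B -> (forall x, `|h x| <= B) -> `|h| <= B.
Proof. exact: sup_norm_le. Qed.

Lemma bfun_complete (F : set_system bfun) : ProperFilter F -> cauchy F -> cvg F.
Proof.
move=> FF /cauchyP Fc; apply/cvg_ex.
have cv x : cvg ((fun h : bfun => h x) @ F).
  apply/cauchy_cvgP/cauchyP => eps eps0; have [h0 hF] := Fc _ eps0.
  exists (h0 x); suff : F [set h : bfun | ball (h0 x) eps (h x)] by [].
  apply: filterS hF => h; rewrite -!ball_normE /= => hh.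
  by apply: le_lt_trans hh; exact: (bfun_norm_ge (h0 - h) x).
pose l x := lim ((fun h : bfun => h x) @ F).
(* The same ball works for every x, which upgrades pointwise to uniform convergence. *)
have ldist h0 eps x : F (ball h0 eps) -> `|h0 x - l x| <= eps.
  move=> hF.
  have hl : (fun h : bfun => `|h0 x - h x|) @ F --> `|h0 x - l x|.
    by apply: cvg_norm; apply: cvgB; [exact: cvg_cst|exact: cv].
  apply: (cvgr_to_le hl); apply: filterS hF => h;
    rewrite -ball_normE /= => /ltW; apply: le_trans.
  exact: (bfun_norm_ge (h0 - h) x).
have lb : l \in bounded_pred.
  have [h0 hF] := Fc _ (ltr01); apply/asboolP; exists (`|h0| + 1) => x.
  rewrite -(subKr (h0 x) (l x)) (le_trans (ler_normB _ _))// lerD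
    ?bfun_norm_ge//.
  exact: ldist.
exists (BFun lb); apply/cvgrPdist_le => eps eps0.
have e20 : 0 < eps / 2 by rewrite divr_gt0.
have [h0 hF] := Fc _ e20; apply: filterS (hF) => h;
  rewrite -ball_normE /= => hh.
apply: bfun_norm_le => [|x]; first exact: ltW.
rewrite (_ : (BFun lb - h) x = (l x - h0 x) + (h0 - h) x); last first.
  by rewrite /= addrA subrK.
rewrite (le_trans (ler_normD _ _))// (splitr eps) lerD//.
  by rewrite distrC ldist.
by rewrite (le_trans (bfun_norm_ge _ _))// ltW.
Qed.

HB.instance Definition _ := Uniform_isComplete.Build bfun bfun_complete.

End bounded_functions.
Arguments bfun : clear implicits.

(** * Projections onto one summand with extremal unit image *)

Section extremal_projection.
Context {R : realType} {n : nat} (mu : probability (@borel_mx R n) R).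
Hypothesis haar_mu : normalized_haar mu.
Context (e : 'rV[R]_n).
Hypothesis e1 : l2norm e = 1.
Local Notation O := (@orthogonal_group R n).
Local Notation u T := (e *m (T : 'M[R]_n)^T).
Local Notation kappa := (mean_abs_coord mu e).
Local Notation mean := (haar_mean mu).

Context (X : Type) (sigma : X -> 'rV[R]_n).
Hypothesis sigma1 : forall x, l2norm (sigma x) <= 1.
Context (p : {linear bfun R X -> 'rV[R]_n}) (iota : 'rV[R]_n -> bfun R X).
Hypothesis iotaE : forall z x, iota z x = dotp z (sigma x).
Hypothesis piota : forall z, p (iota z) = z.
Context (K : set 'rV[R]_n) (M : R).
Hypothesis KM : forall a, K a -> l2norm a <= M.
Hypothesis pK : forall f, `|f| <= 1 -> K (p f).
Hypothesis meanK : mean (fun T => support_fun K (u T)) <= n%:R * kappa.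

(** The p(B) of the overview. In the application [X] is the ball S, [sigma] is the component s_1 or
    s_2, and [K] is A_1 or A_2. *)
Definition unit_image : set 'rV[R]_n := p @` [set f | `|f| <= 1].
Local Notation K' := unit_image.

Lemma unit_image_bound a : K' a -> l2norm a <= M.
Proof. by move=> [f f1 <-]; apply/KM/pK. Qed.

Lemma unit_image_neq0 : K' !=set0.
Proof. by exists (p 0), 0; rewrite //= normr0. Qed.

Lemma enclosing_bound_ge0 : 0 <= M.
Proof.
by have [a /unit_image_bound] := unit_image_neq0; apply: le_trans;
  exact: l2norm_ge0.
Qed.

Lemma l2norm_p_le f : l2norm (p f) <= M * `|f|.
Proof.
have [->|f0] := eqVneq f 0; first by rewrite linear0 l2norm0 normr0 mulr0.
have fp : 0 < `|f| by rewrite normr_gt0.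
have : l2norm (p (`|f|^-1 *: f)) <= M.
  by apply/KM/pK; rewrite normrZ normfV normr_id mulVf// normr_eq0.
by rewrite linearZ/= l2normZ normfV normr_id mulrC ler_pdivrMr.
Qed.

Lemma regular_support_fun L : L !=set0 -> (forall a, L a -> l2norm a <= M) ->
  regular (fun T => support_fun L (u T)) M (M * (n%:R * n%:R)).
Proof.
move=> L0 LM; apply: (@regular_sphere _ _ _ e1 (support_fun L) M M).
- exact: enclosing_bound_ge0.
- move=> x x1; have := support_fun_lipschitz x 0 L0 LM.
  rewrite subr0 x1 mulr1 => h.
  suff -> : support_fun L x = support_fun L x - support_fun L 0 by [].
  by rewrite -(scale0r 0) (support_funZ _ L0 LM)// mul0r subr0.
- by move=> x y; exact: support_fun_lipschitz.
Qed.

(* [p] is tested against f_u(s) = |s_1| sgn <u, s_1> + g(s) <u, b>, the first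
   term being replaced by [clip]. *)
Lemma mean_support_ge_approx (g : bfun R X) b eps : 0 < eps ->
  l2norm b = 1 -> (forall x, l2norm (sigma x) + `|g x| <= 1) ->
  n%:R * kappa + dotp (p g) b / n%:R <=
  mean (fun T => support_fun K' (u T)) + (2 * n%:R + 1) * M * eps.
Proof.
move=> eps0 b1 sg.
have M0 := enclosing_bound_ge0.
pose C : R := n%:R * n%:R.
have C0 : 0 <= C by rewrite mulr_ge0.
pose L := 2 * C + (eps^-1 * C + C).
have L0 : 0 <= L by rewrite !addr_ge0// !mulr_ge0// invr_ge0 ltW.
(* [L] is the Lipschitz constant of the coordinates of f_u(s) u, uniformly in s; M C is that of the
   support function. *)
pose delta := eps / (L + C + 1).
have den : 0 < L + C + 1 by rewrite ltr_wpDl// addr_ge0.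
have delta0 : 0 < delta by rewrite divr_gt0.
have Ld : L * delta <= eps.
  rewrite /delta mulrCA ler_piMr ?(ltW eps0)// ler_pdivrMr// mul1r -addrA lerDl.
  by rewrite addr_ge0.
have Cd : C * delta <= eps.
  rewrite /delta mulrCA ler_piMr ?(ltW eps0)// ler_pdivrMr// mul1r -addrA
    addrCA lerDl.
  by rewrite addr_ge0.
have [J [w [t [w0 w1 Ot _ quad]]]] := quadrature haar_mu delta0.
pose F x T := clip (l2norm (sigma x)) (eps^-1 * dotp (u T) (sigma x)) +
  g x * dotp (u T) b.
have g1 x : `|g x| <= 1.
  by rewrite (le_trans _ (sg x))// lerDr l2norm_ge0.
have F1 x T : O T -> `|F x T| <= 1.
  move=> OT; rewrite (le_trans (ler_normD _ _))// (le_trans _ (sg x))// lerD//.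
    by apply: normr_clip_le; exact: l2norm_ge0.
  rewrite normrM ler_piMr// (le_trans (normr_dotp_le _ _))// b1 mulr1.
  by rewrite sphere_norm.
have Fb j : (fun x => F x (t j)) \in @bounded_pred R X.
  by apply/asboolP; exists 1 => x; exact: F1.
pose f j : bfun R X := BFun (Fb j).
have f1 j : `|f j| <= 1 by apply: bfun_norm_le => // x; exact: F1.
pose d i : 'rV[R]_n := delta_mx 0 i.
have d1 i : l2norm (d i) = 1 by rewrite /l2norm dotp_delta mxE !eqxx sqrtr1.
have regF x i : regular (fun T => F x T * dotp (u T) (d i)) 2 L.
  have rc := regular_clip e1 eps0 (sigma1 x).
  have rb : regular (fun T => g x * dotp (u T) b) 1 C.
    apply: regularW (regularZ (g x) (regular_dotp e1 b));
      rewrite b1 ?mul1r ?mulr1//.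
    by rewrite ler_piMl.
  have := regularM (regularD rc rb) (regular_dotp e1 (d i)).
  by rewrite d1; apply: regularW; rewrite ?mulr1// !mul1r.
have meanF x i : `|mean (fun T => F x T * dotp (u T) (d i)) -
    (kappa * dotp (sigma x) (d i) + g x * (dotp b (d i) / n%:R))| <= eps.
  have bc := regular_bounded (regular_clip e1 eps0 (sigma1 x)).
  have bd z := bounded_dotp e1 z.
  have -> : mean (fun T => F x T * dotp (u T) (d i)) =
      mean (fun T => clip (l2norm (sigma x)) (eps^-1 * dotp (u T) (sigma x)) *
        dotp (u T) (d i))
      + g x * (dotp b (d i) / n%:R).
    rewrite -(mean_dotp_mul haar_mu e1) -haar_meanZ;
      last exact: bounded_measurableM.
    rewrite -haar_meanD//; [|exact:
      bounded_measurableM|exact/bounded_measurableZ/bounded_measurableM].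
    by apply: eq_haar_mean => T _; rewrite /F; ring.
  rewrite opprD addrACA subrr addr0 (le_trans (mean_clip haar_mu e1 _ eps0
    _))//.
  rewrite ler_piMr ?(ltW eps0)// (le_trans (normr_dotp_le _ _))// d1 mulr1//.
(* [G i] is the quadrature sum for the mean of u_i f_u, and [H i] the value this mean would have
   with the exact sign. Smoothing and quadrature each cost [eps]. *)
pose G i := \sum_j (w j * u (t j) 0 i) *: f j.
pose H i := kappa *: iota (d i) + (b 0 i / n%:R) *: g.
have sumE (h : J -> bfun R X) x : (\sum_j h j) x = \sum_j h j x.
  by elim/big_ind2 : _ => // a a' c c' <- <-.
have GH i : `|G i - H i| <= 2 * eps.
  apply: bfun_norm_le => [|x]; first by rewrite mulr_ge0// ltW.
  have -> : (G i - H i) x = \sum_j w j * (F x (t j) * dotp (u (t j)) (d i)) -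
      (kappa * dotp (sigma x) (d i) + g x * (dotp b (d i) / n%:R)).
    rewrite (_ : (G i - H i) x = G i x - H i x)// /G sumE; congr (_ - _).
      apply: eq_bigr => j _; rewrite dotp_delta.
      by rewrite bfunZE -mulrA; congr (_ * _); exact: mulrC.
    rewrite (_ : H i x = kappa * iota (d i) x + (b 0 i / n%:R) * g x)//.
    by rewrite iotaE (dotpC (d i)) !dotp_delta; ring.
  have [mr _ _ lr] := regF x i.
  have := quad _ _ L0 mr lr; have := meanF x i.
  set A := mean _; set B := \sum_j _; set D := kappa * _ + _ => h1 h2.
  rewrite (_ : B - D = (A - D) - (A - B)); last by ring.
  rewrite (le_trans (ler_normB _ _))//; lra.
(* Here [p] passes through the sum over nodes, which is finite. *)
have pf : \sum_j w j * dotp (p (f j)) (u (t j)) = \sum_i p (G i) 0 i.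
  under [RHS]eq_bigr do rewrite /G linear_sum summxE.
  rewrite exchange_big/=; apply: eq_bigr => j _.
  rewrite /dotp mulr_sumr; apply: eq_bigr => i _.
  by rewrite linearZ/= [in RHS]mxE -[in RHS]mulrA; congr (_ * _); exact: mulrC.
have pH : \sum_i p (H i) 0 i = n%:R * kappa + dotp (p g) b / n%:R.
  rewrite /H; under eq_bigr do rewrite linearD !linearZ/= piota !mxE !eqxx
    mulr1.
  rewrite big_split/= sumr_const card_ord mulr_natl; congr (_ + _).
  by rewrite /dotp mulr_suml; apply: eq_bigr => i _; ring.
have pGH : \sum_i p (H i) 0 i <= \sum_i p (G i) 0 i + 2 * n%:R * M * eps.
  rewrite -lerBlDl -sumrB.
  have -> : 2 * n%:R * M * eps = \sum_(i < n) M * (2 * eps).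
    by rewrite sumr_const card_ord -mulr_natl; ring.
  apply: ler_sum => i _.
  have -> : p (H i) 0 i - p (G i) 0 i = p (H i - G i) 0 i by rewrite linearB
    !mxE.
  rewrite (le_trans (ler_norm _))// (le_trans (normr_coord_le _ _))//.
  by rewrite (le_trans (l2norm_p_le _))// ler_wpM2l// distrC.
have pS : \sum_j w j * dotp (p (f j)) (u (t j)) <=
    \sum_j w j * support_fun K' (u (t j)).
  apply: ler_sum => j _; rewrite ler_wpM2l//.
  by apply: (support_fun_ge _ unit_image_bound); exists (f j) => //; exact: f1.
have [mr Lr _ lr] := regular_support_fun unit_image_neq0 unit_image_bound.
have := quad _ _ Lr mr lr; rewrite ler_norml => /andP[q1 _].
have MC : M * C * delta <= M * eps by rewrite -mulrA ler_wpM2l.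
(* The error is 2 n M eps from replacing [H] by [G], plus M eps from the quadrature of the support
   function. *)
rewrite -pH; move: q1 pS pGH; rewrite pf -/C; lra.
Qed.

Lemma mean_support_ge (g : bfun R X) b :
  l2norm b = 1 -> (forall x, l2norm (sigma x) + `|g x| <= 1) ->
  n%:R * kappa + dotp (p g) b / n%:R <= mean (fun T => support_fun K' (u T)).
Proof.
move=> b1 sg; apply/ler_addgt0Pr => eta eta0.
have M0 := enclosing_bound_ge0.
pose c := (2 * n%:R + 1) * M.
have c0 : 0 <= c by rewrite mulr_ge0// addr_ge0// mulr_ge0.
have c1 : 0 < c + 1 by rewrite ltr_wpDl.
have h := mean_support_ge_approx (divr_gt0 eta0 c1) b1 sg.
rewrite (le_trans h)// lerD2l -/c mulrCA ler_piMr ?(ltW eta0)//.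
by rewrite ler_pdivrMr// mul1r lerDl.
Qed.

Lemma bounded_support L : L !=set0 -> (forall a, L a -> l2norm a <= M) ->
  bounded_measurable (fun T => support_fun L (u T)).
Proof. by move=> L0 LM; apply: regular_bounded (regular_support_fun L0 LM). Qed.

Lemma enclosing_neq0 : K !=set0.
Proof. by exists (p 0); apply: pK; rewrite normr0. Qed.

Lemma support_unit_image_le x : support_fun K' x <= support_fun K x.
Proof.
apply: support_fun_le; first exact: unit_image_neq0.
by move=> _ [f f1 <-]; apply: (support_fun_ge _ KM); exact: pK.
Qed.

(** With b the direction of p g, a nonzero p g would lift the mean of the support function of p(B)
    above n kappa, the bound assumed for [K]. *)
Lemma projection_vanish (g : bfun R X) :
  (forall x, l2norm (sigma x) + `|g x| <= 1) -> p g = 0.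
Proof.
move=> sg; apply: contrapT => /eqP pg0.
have := mean_support_ge (l2norm_unit pg0) sg.
have : mean (fun T => support_fun K' (u T)) <= mean (fun T => support_fun K (u
  T)).
  apply: haar_mean_le => //; [exact: bounded_support unit_image_neq0
    unit_image_bound|exact: bounded_support enclosing_neq0 KM|].
  by move=> T _; exact: support_unit_image_le.
move=> /le_trans/(_ meanK) h1 /le_trans/(_ h1).
rewrite gerDl leNgt => /negP; apply; rewrite divr_gt0//.
  rewrite dotpZr mulr_gt0// ?invr_gt0.
    by rewrite lt_def l2norm_ge0 andbT; apply: contra_neq pg0 => /l2norm_eq0.
  by rewrite lt_def dotp_ge0 andbT; apply: contra_neq pg0 => /dotp_eq0.
rewrite ltr0n lt0n; apply: contra_neq pg0 => n0.
by move: (p g); rewrite n0 => q; rewrite thinmx0.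
Qed.

(** The gap is nonnegative, Lipschitz and of mean at most 0. Rather than showing that a cap around v
    has positive measure, finitely many rotated copies of the gap are summed: each has mean at most
    0, yet a positive gap at v would keep the sum above a positive constant. *)
Lemma support_unit_image_unit v : l2norm v = 1 ->
  support_fun K v <= support_fun K' v.
Proof.
move=> v1; rewrite leNgt; apply/negP => lt_v.
pose gap x := support_fun K x - support_fun K' x.
have gapv : 0 < gap v by rewrite subr_gt0.
have M0 := enclosing_bound_ge0.
pose C : R := n%:R * n%:R.
have C0 : 0 <= C by rewrite mulr_ge0.
(* Moving the rotation by [delta] changes the gap by at most 2 M C delta, which is at most half of
   [gap v]. *)
pose delta := gap v / (2 * (2 * M * C) + 1).
have den : 0 < 2 * (2 * M * C) + 1 by rewrite ltr_wpDl// !mulr_ge0.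
have delta0 : 0 < delta by rewrite divr_gt0.
have cd : 2 * (2 * M * C * delta) <= gap v.
  rewrite mulrA /delta mulrCA ler_piMr ?(ltW gapv)// ler_pdivrMr// mul1r.
  by rewrite lerDl.
have [J [_ [t [_ _ Ot dense _]]]] := quadrature haar_mu delta0.
have bK := bounded_support enclosing_neq0 KM.
have bK' := bounded_support unit_image_neq0 unit_image_bound.
have bgap : bounded_measurable (fun T => gap (u T)).
  have -> : (fun T => gap (u T)) =
      (fun T => support_fun K (u T) + (-1) * support_fun K' (u T)).
    by apply/funext => T; rewrite mulN1r.
  by apply: bounded_measurableD => //; exact: bounded_measurableZ.
have mgap : mean (fun T => gap (u T)) <= 0.
  have -> : mean (fun T => gap (u T)) =
      mean (fun T => support_fun K (u T) + (-1) * support_fun K' (u T)).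
    by apply: eq_haar_mean => T _; rewrite mulN1r.
  rewrite haar_meanD//; last exact: bounded_measurableZ.
  rewrite haar_meanZ// mulN1r subr_le0 (le_trans meanK)//.
  have := @mean_support_ge 0 v v1; rewrite linear0 dotp0l mul0r addr0; apply.
  by move=> x; rewrite normr0 addr0.
have gap_lip x y : gap x - gap y <= 2 * M * l2norm (x - y).
  have := support_fun_lipschitz x y enclosing_neq0 KM.
  have := support_fun_lipschitz x y unit_image_neq0 unit_image_bound.
  by rewrite !ler_norml /gap => /andP[? ?] /andP[? ?]; lra.
have gap_ge0 x : 0 <= gap x by rewrite subr_ge0 support_unit_image_le.
have Ott j : O (t j)^T by exact: orthogonal_trmx.
have : gap v / 2 <= mean (fun T => \sum_j gap (u ((t j)^T *m T))).
  rewrite -(haar_mean_cst haar_mu (gap v / 2)); apply: haar_mean_le => //.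
    exact: bounded_measurable_cst.
    apply: bounded_measurable_sum => j.
    exact: (bounded_measurable_mulmx (f := fun T => gap (u T))).
  move=> T OT.
  have [U OU Uv] : exists2 U, O U & (u T) *m U = v.
    by apply: orthogonal_transitive; rewrite sphere_norm.
  have [j tj] := dense U OU.
  rewrite (bigD1 j)//= ler_wpDr ?sumr_ge0//.
  rewrite sphere_mulmx trmxK.
  (* By density of the nodes, some rotation in the sum takes [u T] close to [v];
   the mean of each summand is [mean gap <= 0]. *)
  have := gap_lip v (u T *m t j).
  rewrite -{2}Uv -mulmxBr => h.
  have : 2 * M * l2norm (u T *m (U - t j)) <= 2 * M * C * delta.
    rewrite -!(mulrA (2 * M)) ler_wpM2l ?mulr_ge0// (le_trans (l2norm_mulmx_le
      _ _))//.
    by rewrite sphere_norm// mulr1 mulrA ler_wpM2l.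
  lra.
rewrite haar_mean_sum//; last first.
  by move=> j; apply: (bounded_measurable_mulmx (f := fun T => gap (u T))).
rewrite leNgt => /negP; apply.
rewrite (@le_lt_trans _ _ 0)// ?divr_gt0//.
apply: sumr_le0 => j _.
by rewrite (haar_mean_mulmx haar_mu (f := fun T => gap (u T))).
Qed.

Lemma support_unit_image x : support_fun K x = support_fun K' x.
Proof.
apply/eqP; rewrite eq_le support_unit_image_le andbT.
have K'0 := unit_image_neq0; have K'M := unit_image_bound.
have [->|x0] := eqVneq x 0.
  by rewrite -(scale0r 0) (support_funZ _ enclosing_neq0 KM)// (support_funZ _
    K'0 K'M)// !mul0r.
have l0 : l2norm x != 0 by apply: contra_neq x0 => /l2norm_eq0.
have -> : x = l2norm x *: ((l2norm x)^-1 *: x) by rewrite scalerA divff//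
  scale1r.
rewrite (support_funZ _ enclosing_neq0 KM) ?l2norm_ge0// (support_funZ _ K'0
  K'M) ?l2norm_ge0//.
by rewrite ler_wpM2l ?l2norm_ge0// support_unit_image_unit// l2norm_unit.
Qed.

End extremal_projection.

(** * Separating a point from a closed convex set *)

Section separation.
Context {R : realType} {n : nat}.
Implicit Types (A : set 'rV[R]_n) (x y : 'rV[R]_n).

Lemma bounded_set_l2norm A : bounded_set A ->
  exists M, forall a, A a -> l2norm a <= M.
Proof.
move=> [M [_ hM]]; exists (n%:R * (M + 1)) => a Aa.
rewrite (le_trans (l2norm_le_norm _))// ler_wpM2l//.
by apply: hM => //; rewrite ltrDl.
Qed.

Lemma convex_set_segment A x y t :
  convex_set (A : set (convex_lmodType 'rV[R]_n)) -> A x -> A y ->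
  0 <= t -> t <= 1 -> A (x + t *: (y - x)).
Proof.
move=> cA Ax Ay t0 t1.
have := cA y x (Itv01 t0 t1); rewrite !inE => /(_ Ay Ax).
rewrite /conv/= /unstable.onem scalerBl scale1r (_ : x + _ = t *: y + (x - t *:
  x))//.
by rewrite scalerBr addrCA.
Qed.

Lemma dotpD_line x y t : dotp (x + t *: y) (x + t *: y) =
  dotp x x + t * (2 * dotp y x) + t * (t * dotp y y).
Proof. by rewrite dotpDl !dotpDr !dotpZl !dotpZr (dotpC x y); ring. Qed.

Lemma support_fun_separation A a : bounded_set A -> closed A ->
  convex_set (A : set (convex_lmodType 'rV[R]_n)) -> A !=set0 ->
  (forall x, dotp a x <= support_fun A x) -> A a.
Proof.
move=> bA clA cA A0 ha.
have cf : continuous (fun y => l2norm (y - a)).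
  apply: (@lipschitz_continuous_fun _ _ _ _ n%:R) => x y.
  have step u v : l2norm (u - a) - l2norm (v - a) <= l2norm (u - v).
    rewrite lerBlDr (le_trans _ (l2normD _ _))// addrA subrK//.
  apply: (le_trans _ (l2norm_le_norm _)).
  rewrite ler_norml; apply/andP; split; last exact: step.
  by rewrite lerNl opprB -(l2normN (x - y)) opprB; exact: step.
have [y0] := compact_EVT_min A0 (bounded_closed_compact bA clA)
  (continuous_subspaceT cf).
rewrite inE => Ay0 ymin.
have {}ymin y : A y -> dotp (y0 - a) (y0 - a) <= dotp (y - a) (y - a).
  move=> Ay; rewrite -!l2norm_sqr ler_pXn2r ?nnegrE ?l2norm_ge0//.
  by apply: ymin; rewrite inE.
(* The variational inequality of the nearest point: if d > 0, moving from y0 towards y by t changes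
   the squared distance by t^2 q - 2 t d, negative for the small t chosen here. *)
have var y : A y -> dotp y (a - y0) <= dotp y0 (a - y0).
  move=> Ay; rewrite -subr_le0 -dotpBl leNgt; apply/negP => d0.
  set d := dotp _ _ in d0; pose q := dotp (y - y0) (y - y0).
  have q0 : 0 <= q by exact: dotp_ge0.
  pose t := Num.min 1 (d / (q + 1)).
  have q1 : 0 < q + 1 by rewrite ltr_wpDl.
  have t0 : 0 < t by rewrite lt_min ltr01 divr_gt0.
  have t1 : t <= 1 by rewrite ge_min lexx.
  have tq : t * (q + 1) <= d by rewrite -ler_pdivlMr// ge_min lexx orbT.
  have := ymin _ (convex_set_segment cA Ay0 Ay (ltW t0) t1).
  rewrite (addrAC y0) dotpD_line -/q.
  have -> : dotp (y - y0) (y0 - a) = - d by rewrite -dotpNr opprB.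
  have : 0 < t * d by rewrite mulr_gt0.
  have : t * (t * (q + 1)) <= t * d by rewrite ler_pM2l.
  have : 0 < t * t by rewrite mulr_gt0.
  lra.
(* The hypothesis is applied in the direction a - y0, where y0 attains the support function. *)
have : dotp (a - y0) (a - y0) <= 0.
  rewrite dotpBl subr_le0 (le_trans (ha _))//.
  by apply: support_fun_le => // y /var.
move=> ay; have /dotp_eq0/eqP : dotp (a - y0) (a - y0) = 0.
  by apply/eqP; rewrite eq_le ay dotp_ge0.
by rewrite subr_eq0 => /eqP ->.
Qed.

End separation.

(** * Smallness as a bound on the mean support function *)

Section small.
Context {R : realType}.

(** In dimension 0 the projection is the zero map, so every positive number is a bound and none is
    the least. A positive dimension provides the unit vector [e]. *)
Lemma absolute_projection_constant_dim_gt0 n (c : R) :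
  absolute_projection_constant (@l2norm R n) c -> (0 < n)%N.
Proof.
case: n => // -[c0 _ cmin]; exfalso.
suff : c <= c / 2 by lra.
apply: cmin; first by lra.
move=> Y i _; have lin0 : linear (fun _ : Y => 0 : Y).
  by move=> a x y; rewrite scaler0 addr0.
pose P : {linear Y -> Y} :=
  HB.pack (fun _ : Y => 0 : Y) (GRing.isLinear.Build _ _ _ _ (fun _ : Y => 0 :
    Y) lin0).
exists P.
  split.
  - by move=> x; exact: cvg_cst.
  - apply/seteqP; split => [_ [y _ <-]|_ [x _ <-]].
      by exists 0 => //; rewrite linear0.
    by exists 0 => //=; rewrite [x]thinmx0 linear0.
  - by move=> x; rewrite [x]thinmx0 linear0.
by move=> y; rewrite normr0 mulr_ge0//; lra.
Qed.

(** At a unit vector e the support function of the Minkowski integral equals lambda(l_2^n), which is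
    at most n kappa. *)
Lemma small_mean_support n (A : set 'rV[R]_n) :
  small_sufficient_enlargement A ->
  exists (mu : probability (@borel_mx R n) R) (e : 'rV[R]_n),
  [/\ normalized_haar mu, l2norm e = 1 &
    haar_mean mu (fun T => support_fun A (e *m T^T)) <=
      n%:R * mean_abs_coord mu e].
Proof.
move=> [_ [mu [c [hmu hc [_ _ _ hint]]]]].
have n0 := absolute_projection_constant_dim_gt0 hc.
pose e : 'rV[R]_n := delta_mx 0 (Ordinal n0).
have e1 : l2norm e = 1 by rewrite /l2norm dotp_delta mxE !eqxx sqrtr1.
exists mu, e; split => //.
apply: le_trans (absolute_projection_constant_le hmu e1 hc).
have c0 : 0 <= c by case: hc => /ltW.
have := hint e; rewrite support_fun_l2ball// e1 mulr1 => hce.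
rewrite /haar_mean /Rintegral.
under eq_integral do rewrite -support_fun_mx_image.
by rewrite -hce.
Qed.

End small.

(** * Embedding into the bounded functions on the unit ball *)

Section universal_embedding.
Context {R : realType} {n : nat}.

Definition l2ball_type : Type := {s : 'rV[R]_n | l2norm s <= 1}.

Lemma dotp_bounded_pred (z : 'rV[R]_n) :
  (fun s : l2ball_type => dotp z (val s)) \in @bounded_pred R l2ball_type.
Proof.
apply/asboolP; exists (l2norm z) => s.
by rewrite (le_trans (normr_dotp_le _ _))// ler_piMr ?l2norm_ge0//; case: s.
Qed.

Definition eval_embedding (z : 'rV[R]_n) : bfun R l2ball_type :=
  BFun (dotp_bounded_pred z).

Lemma eval_embedding_linear : linear eval_embedding.
Proof. by move=> a x y; apply: bfunP => s /=; rewrite dotpDl dotpZl. Qed.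

HB.instance Definition _ := GRing.isLinear.Build R 'rV[R]_n (bfun R l2ball_type)
  _ eval_embedding eval_embedding_linear.

Lemma eval_embedding_isometric :
  isometric_embedding (@l2norm R n) eval_embedding.
Proof.
move=> z; apply/eqP; rewrite eq_le; apply/andP; split.
  apply: bfun_norm_le => [|s]; first exact: l2norm_ge0.
  by rewrite (le_trans (normr_dotp_le _ _))// ler_piMr ?l2norm_ge0//; case: s.
have [->|z0] := eqVneq z 0; first by rewrite l2norm0.
have s1 : l2norm ((l2norm z)^-1 *: z) <= 1 by rewrite l2norm_unit.
pose s : l2ball_type := exist (fun x : 'rV[R]_n => l2norm x <= 1) _ s1.
apply: le_trans (bfun_norm_ge (eval_embedding z) s);
  rewrite /= dotpZr -l2norm_sqr.
rewrite expr2 mulrA mulVf ?mul1r ?ler_norm//.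
by apply: contra_neq z0 => /l2norm_eq0.
Qed.

Lemma l2norm_delta i : l2norm (delta_mx 0 i : 'rV[R]_n) <= 1.
Proof. by rewrite /l2norm dotp_delta mxE !eqxx sqrtr1. Qed.

Lemma sufficient_enlargement_projection (A : set 'rV[R]_n) :
  sufficient_enlargement (@l2norm R n) A ->
  exists p : {linear bfun R l2ball_type -> 'rV[R]_n},
    (forall z, p (eval_embedding z) = z) /\ (forall f, `|f| <= 1 -> A (p f)).
Proof.
move=> [_ /(_ (bfun R l2ball_type) eval_embedding eval_embedding_isometric)].
move=> [P [_ _ Pi] PA].
(* The basis vectors belong to the ball, so evaluation at them recovers z from the function <z,
   .>. *)
pose p (f : bfun R l2ball_type) : 'rV[R]_n :=
  \row_i (P f) (exist (fun x : 'rV[R]_n => l2norm x <= 1) _ (l2norm_delta i)).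
have plin : linear p.
  by move=> a f g; apply/rowP => i; rewrite !mxE linearP.
have pi z : forall f, P f = eval_embedding z -> p f = z.
  by move=> f Pf; apply/rowP => i; rewrite mxE Pf /= dotp_delta.
pose p' : {linear bfun R l2ball_type -> 'rV[R]_n} :=
  HB.pack p (GRing.isLinear.Build _ _ _ _ p plin).
exists p'; split => [z|f f1] /=.
  by apply: pi; rewrite Pi.
have [a Aa /esym aE] : (eval_embedding @` A) (P f) by apply: PA; exists f.
by rewrite (pi a).
Qed.

End universal_embedding.

(** * Gluing functions for the two summands *)

Section direct_sum.
Context {R : realType} {n m : nat}.
Local Notation X := (@l2ball_type R (n + m)).
Local Notation Y := (bfun R X).

Lemma splice_bounded (f g : Y) (D : pred X) :
  (fun x => if D x then f x else g x) \in @bounded_pred R X.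
Proof.
apply/asboolP; exists (Num.max `|f| `|g|) => x.
by rewrite le_max; case: ifP => _; rewrite bfun_norm_ge ?orbT.
Qed.

Definition splice (f g : Y) D : Y := BFun (splice_bounded f g D).

Lemma splice_norm_le1 (f g : Y) D : `|f| <= 1 -> `|g| <= 1 -> `|splice f g D|
  <= 1.
Proof.
move=> f1 g1; apply: bfun_norm_le => // x /=.
by case: ifP => _; rewrite (le_trans (bfun_norm_ge _ _)).
Qed.

(* On {|sigma| <= 3/4} there is room for f - g up to the factor 1/8. *)
Lemma projection_agree k (sigma : X -> 'rV[R]_k) (p : {linear Y -> 'rV[R]_k})
    (f g : Y) :
  (forall h : Y, (forall x, l2norm (sigma x) + `|h x| <= 1) -> p h = 0) ->
  (forall x, l2norm (sigma x) <= 1) -> `|f| <= 1 -> `|g| <= 1 ->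
  (forall x, 3 / 4 < l2norm (sigma x) -> f x = g x) -> p f = p g.
Proof.
move=> pv s1 f1 g1 fg; apply/eqP; rewrite -subr_eq0 -linearB.
have : p (8^-1 *: (f - g)) = 0.
  apply: pv => x.
  rewrite (_ : (8^-1 *: (f - g)) x = 8^-1 * (f x - g x))//.
  have [/fg ->|sx] := ltP (3 / 4) (l2norm (sigma x)).
    by rewrite subrr mulr0 normr0 addr0.
  have : `|f x - g x| <= 2.
    rewrite (le_trans (ler_normB _ _))// (_ : 2 = 1 + 1 :> R)//.
    by rewrite lerD// (le_trans (bfun_norm_ge _ _)).
  rewrite normrM gtr0_norm ?invr_gt0//; lra.
by move=> /eqP; rewrite linearZ/= scaler_eq0 invr_eq0 pnatr_eq0.
Qed.

Lemma l2norm_lsubmx_sqr (s : 'rV[R]_(n + m)) :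
  l2norm (lsubmx s) ^+ 2 + l2norm (rsubmx s) ^+ 2 = l2norm s ^+ 2.
Proof. by rewrite !l2norm_sqr dotp_row_mx. Qed.

Lemma l2norm_lsubmx_le1 (x : X) : l2norm (lsubmx (val x)) <= 1.
Proof.
rewrite -(ler_pXn2r (ltn0Sn 1)) ?nnegrE ?l2norm_ge0// expr1n.
rewrite (@le_trans _ _ (l2norm (val x) ^+ 2)) ?expr_le1 ?l2norm_ge0 ?(valP x)//.
by rewrite -l2norm_lsubmx_sqr lerDl sqr_ge0.
Qed.

Lemma l2norm_rsubmx_le1 (x : X) : l2norm (rsubmx (val x)) <= 1.
Proof.
rewrite -(ler_pXn2r (ltn0Sn 1)) ?nnegrE ?l2norm_ge0// expr1n.
rewrite (@le_trans _ _ (l2norm (val x) ^+ 2)) ?expr_le1 ?l2norm_ge0 ?(valP x)//.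
by rewrite -l2norm_lsubmx_sqr lerDr sqr_ge0.
Qed.

(** Since 2 (3/4)^2 = 9/8 > 1, the two components cannot both exceed 3/4. *)
Lemma l2norm_rsubmx_small (x : X) :
  3 / 4 < l2norm (rsubmx (val x)) -> l2norm (lsubmx (val x)) <= 3 / 4.
Proof.
move=> h; rewrite leNgt; apply/negP => h'.
have : l2norm (val x) ^+ 2 <= 1 by rewrite expr_le1 ?l2norm_ge0 ?(valP x).
rewrite -l2norm_lsubmx_sqr; nra.
Qed.

Lemma sum_projections_subset (A : set 'rV[R]_(n + m)) a1 a2 :
  sufficient_enlargement (@l2norm R (n + m)) A ->
  small_sufficient_enlargement (lsubmx @` A : set 'rV[R]_n) ->
  small_sufficient_enlargement (rsubmx @` A : set 'rV[R]_m) ->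
  (lsubmx @` A : set 'rV[R]_n) a1 -> (rsubmx @` A : set 'rV[R]_m) a2 ->
  A (row_mx a1 a2).
Proof.
move=> hA hA1 hA2 Aa1 Aa2.
have [[bA clA cA _ _] _] := hA.
have [[[bA1 _ _ _ _] _] _] := hA1; have [[[bA2 _ _ _ _] _] _] := hA2.
have [M AM] := bounded_set_l2norm bA.
have [M1 A1M] := bounded_set_l2norm bA1.
have [M2 A2M] := bounded_set_l2norm bA2.
have [mu1 [e1 [hmu1 e11 mean1]]] := small_mean_support hA1.
have [mu2 [e2 [hmu2 e21 mean2]]] := small_mean_support hA2.
have [p [pE pA]] := sufficient_enlargement_projection hA.
have lin1 : linear (fun f => lsubmx (p f) : 'rV[R]_n) by move=> a f g;
  rewrite !linearP.
have lin2 : linear (fun f => rsubmx (p f) : 'rV[R]_m) by move=> a f g;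
  rewrite !linearP.
pose p1 : {linear Y -> 'rV[R]_n} :=
  HB.pack (fun f => lsubmx (p f) : 'rV[R]_n) (GRing.isLinear.Build _ _ _ _ (fun
    f => lsubmx (p f) : 'rV[R]_n) lin1).
pose p2 : {linear Y -> 'rV[R]_m} :=
  HB.pack (fun f => rsubmx (p f) : 'rV[R]_m) (GRing.isLinear.Build _ _ _ _ (fun
    f => rsubmx (p f) : 'rV[R]_m) lin2).
pose s1 (x : X) : 'rV[R]_n := lsubmx (val x).
pose s2 (x : X) : 'rV[R]_m := rsubmx (val x).
pose i1 (z : 'rV[R]_n) : Y := eval_embedding (row_mx z 0).
pose i2 (z : 'rV[R]_m) : Y := eval_embedding (row_mx 0 z).
have i1E z x : i1 z x = dotp z (s1 x).
  by rewrite /= dotp_row_mx row_mxKl row_mxKr dotp0l addr0.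
have i2E z x : i2 z x = dotp z (s2 x).
  by rewrite /= dotp_row_mx row_mxKl row_mxKr dotp0l add0r.
have p1i z : p1 (i1 z) = z by rewrite /= pE row_mxKl.
have p2i z : p2 (i2 z) = z by rewrite /= pE row_mxKr.
have p1K f : `|f| <= 1 -> (lsubmx @` A : set 'rV[R]_n) (p1 f).
  by move=> f1; exists (p f) => //; exact: pA.
have p2K f : `|f| <= 1 -> (rsubmx @` A : set 'rV[R]_m) (p2 f).
  by move=> f1; exists (p f) => //; exact: pA.
have v1 := projection_vanish hmu1 e11 l2norm_lsubmx_le1 i1E p1i A1M p1K mean1.
have v2 := projection_vanish hmu2 e21 l2norm_rsubmx_le1 i2E p2i A2M p2K mean2.
have h1 := support_unit_image hmu1 e11 l2norm_lsubmx_le1 i1E p1i A1M p1K mean1.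
have h2 := support_unit_image hmu2 e21 l2norm_rsubmx_le1 i2E p2i A2M p2K mean2.
(* [A] is closed, bounded and convex, so comparing support functions suffices. *)
apply: support_fun_separation => //.
  by exists (p 0); apply: pA; rewrite normr0.
move=> x; rewrite dotp_row_mx row_mxKl row_mxKr.
rewrite (le_trans (lerD (support_fun_ge _ A1M Aa1) (support_fun_ge _ A2M
  Aa2)))//.
(* The support functions of A_1 and A_2 are now those of p_1(B) and p_2(B), so it is enough to treat
   one f and one g in B. *)
rewrite h1 h2 -lerBrDr; apply: support_fun_le; first exact: unit_image_neq0.
move=> _ [f f1 <-]; rewrite lerBrDr addrC -lerBrDr.
apply: support_fun_le; first exact: unit_image_neq0.
move=> _ [g g1 <-]; rewrite lerBrDr addrC.
pose D (y : X) := 3 / 4 < l2norm (s1 y).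
pose q := splice f g D.
have q1 : `|q| <= 1 by exact: splice_norm_le1.
have -> : p1 f = p1 q.
  apply: (projection_agree v1 l2norm_lsubmx_le1) => // y sy.
  by rewrite /q /= /D sy.
have -> : p2 g = p2 q.
  apply: (projection_agree v2 l2norm_rsubmx_le1) => // y /l2norm_rsubmx_small
    sy.
  by rewrite /q /= /D ltNge sy.
rewrite /= -dotp_row_mx; apply: (support_fun_ge _ AM); exact: pA.
Qed.

End direct_sum.

Theorem theorem5 (R : realType) (n m : nat) (A : set 'rV[R]_(n + m))
    (hA : sufficient_enlargement (@l2norm R (n + m)) A)
    (hA1 : small_sufficient_enlargement (lsubmx @` A : set 'rV[R]_n))
    (hA2 : small_sufficient_enlargement (rsubmx @` A : set 'rV[R]_m)) :
  A = minkowski_sum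
        (@embed_l R n m @` (lsubmx @` A : set 'rV[R]_n))
        (@embed_r R n m @` (rsubmx @` A : set 'rV[R]_m)).
Proof.
apply/seteqP; split => [a Aa|_ [_ [a1 Aa1 <-]] [_ [a2 Aa2 <-] <-]].
  exists (embed_l m (lsubmx a)); first by exists (lsubmx a) => //; exists a.
  exists (embed_r n (rsubmx a)); first by exists (rsubmx a) => //; exists a.
  by rewrite /embed_l /embed_r add_row_mx addr0 add0r hsubmxK.
rewrite /embed_l /embed_r add_row_mx addr0 add0r.
exact: sum_projections_subset.
Qed.
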